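(* Let $p_0$ be the true density of a single observation. Let $\pi(m,df)=\pi_m\,\pi(df\mid m)$ be a model-averaging prior over model indexes $m\in M$ and densities $f\in\mathcal{P}_m$, where the models are nonoverlapping, and let $p=p^{(n)}$, $n=1,2,\dots$, be a posterior sequence of random densities for iid data under this prior. Let $u\in\{1/2,1/3,1/4,\dots\}$ and $0<t<\infty$. Then, with probability $1$, for all sufficiently large sample sizes $n$, $$d_{-u}^2(p_0,p^{(n)})\le d_t^2(p_0,\pi)+n^{-1}\ln\left[N_u(\pi)\,n^{2(u^{-1}+t^{-1})}\right],$$ where $d_t^2(p_0,\pi)=\inf_{K\subset\mathcal{P}}\left[\sup_{q\in K}d_t^2(p_0,q)-n^{-1}\ln\pi(K)\right]$ and $N_u(\pi)$ is the infimum of $$\left[\sum_{m\in M}\sum_{j\in\mathcal{N}_m}\{\pi_m\,\pi(B_{mj}\mid m)\}^u\right]^{1/u}$$ over all covers $\bigcup_{m\in M}\bigcup_{j\in\mathcal{N}_m}B_{mj}$ of $\mathcal{P}$ such that each $B_{mj}$ is an $L_1$ ball of radius $n^{-1/u}$ and, for each $m$, $\bigcup_{j\in\mathcal{N}_m}B_{mj}$ is a countable cover of $\mathcal{P}_m$. Moreover, $$N_u(\pi)=\left[\sum_{m\in M}\{\pi_m\,N_u(\pi(\cdot\mid m))\}^u\right]^{1/u},$$ where $N_u(\pi(\cdot\mid m))$ is the infimum of $\left[\sum_{j\in\mathcal{N}}\pi(B_j\mid m)^u\right]^{1/u}$ over all countable covers $\bigcup_{j\in\mathcal{N}}B_j$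 of $\mathcal{P}_m$ by $L_1$ balls $B_j$ of radius $n^{-1/u}$.
   Context: All densities are probability densities of a single observation $Y$ with respect to a common dominating measure. All sets to which priors are applied are measurable. An $L_1$ ball of radius $r$ is a ball in the set of densities for the distance $\int|f-g|$. The quantities $N_u(\pi)$, $N_u(\pi(\cdot\mid m))$ and $d_t^2(p_0,\pi)$ depend on $n$; covers may use infinitely (countably) many balls, and the infima are $+\infty$ if no suitable cover has a finite sum (the bound is then trivial). The convention $-\ln0=+\infty$ is used. Prior: $M$ is a countable set of model indexes, $\pi_m>0$ ($m\in M$) are model probabilities, $\pi(df\mid m)$ is the prior given model $m$, with support $\mathcal{P}_m$, and $\mathcal{P}_m\cap\mathcal{P}_{m'}=\emptyset$ for $m\ne m'$ (nonoverlapping models). The mixing prior is $\pi(df)=\sum_{m\in M}\pi_m\,\pi(df\mid m)$, with support $\mathcal{P}=\bigcup_{m\in M}\mathcal{P}_m$. Divergence: for $t>-1$, $t\ne0$, and densities $p,q$, $d_t^2(p,q)=t^{-1}\int p\left((p/q)^t-1\right)$, i.e. $1+t\,d_t^2(p,q)=\int p^{1+t}q^{-t}$ (for $t>0$ this is $+\infty$ if $q=0$ on a set of positive $p$-probability; points with $p=0$ contribute $0$). Posterior sequence of random densities for iid data: a sequence $p^{(n)}$ (labeled by the sample size $n$) of random density functions in $\mathcal{P}$, defined on one probability space, such that for every $n$ and every subset $A\subset\mathcal{P}$, $$\Pr\left[p^{(n)}\in A\right]=\int\left[\frac{\int_{f\in A}\prod_{i=1}^nf(Y_i)\,\pi(df)}{\int_{f\in\mathcal{P}}\prod_{i=1}^nf(Y_i)\,\pi(df)}\right]\prod_{i=1}^np_0(Y_i)\,dY_i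 ,$$ the ratio being assumed well defined almost surely. That is, for each $n$, $p^{(n)}$ is marginally distributed as a draw from the posterior given $n$ iid observations from $p_0$; nothing is assumed about the joint law across different $n$. *)

(* Defs.v *)
From HB Require Import structures.
From mathcomp Require Import all_boot all_order all_algebra.
From mathcomp Require Import all_classical all_reals all_analysis.

Set Implicit Arguments.
Unset Strict Implicit.
Unset Printing Implicit Defensive.

Import Order.TTheory GRing.Theory Num.Theory.
Import numFieldNormedType.Exports.

Local Open Scope classical_set_scope.
Local Open Scope ring_scope.
Local Open Scope ereal_scope.

Section densities.
Context {d : measure_display} {T : measurableType d} {R : realType}.
Variable mu : {sigma_finite_measure set T -> \bar R}.

(* Densities are genuine functions, not classes modulo [mu]-a.e. equality. *)
Definition is_density (f : T -> R) : Prop :=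
  [/\ measurable_fun [set: T] f, (forall y, (0 <= f y)%R)
    & \int[mu]_y (f y)%:E = 1].

(* The open ball; its centre [c] is meant to be a density. *)
Definition L1ball (c : T -> R) (r : R) : set (T -> R) :=
  [set f | is_density f /\ \int[mu]_y `|f y - c y|%:E < r%:E].

(* p ((p/q)^s - 1) at the point [y]. Real division by 0 gives 0 and
   0 `^ s = 0 for s != 0, so the real formula is right except for s > 0,
   p y != 0 and q y = 0, where the value is +oo. *)
Definition dsq_integrand (s : R) (p q : T -> R) (y : T) : \bar R :=
  if [&& (0 < s)%R, p y != 0%R & q y == 0%R] then +oo
  else (p y * ((p y / q y) `^ s - 1))%:E.

Definition dsq (s : R) (p q : T -> R) : \bar R :=
  (s^-1)%:E * \int[mu]_y dsq_integrand s p q y.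

(* The integral of [phi] over T^n for the n-fold product of [mu], written as
   an iterated integral. *)
Fixpoint iter_integral (n : nat) : (n.-tuple T -> \bar R) -> \bar R :=
  match n with
  | 0%N => fun phi => phi [tuple]
  | k.+1 => fun phi =>
      \int[mu]_y iter_integral (fun ys : k.-tuple T => phi [tuple of y :: ys])
  end.

Definition likelihood (n : nat) (Y : n.-tuple T) (f : T -> R) : R :=
  (\prod_(i < n) f (tnth Y i))%R.

(* An arbitrary sigma-algebra on the space of functions is given by a family
   [G] generating it. *)
Variable G : set (set (T -> R)).
Local Notation D := (g_sigma_algebraType G).

Definition weighted_likelihood (pi : probability D R) (n : nat)
    (Y : n.-tuple T) (A : set D) : \bar R :=
  \int[pi]_(f in A) (likelihood Y f)%:E.

Definition posterior_defined (pi : probability D R) (P : set D)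
    (p0 : T -> R) (n : nat) : Prop :=
  iter_integral (fun Y : n.-tuple T =>
    (\1_[set Z : n.-tuple T | ~ (0 < weighted_likelihood pi Z P < +oo)%E] Y)%:E
    * (likelihood Y p0)%:E) = 0.

Definition posterior_sequence (pi : probability D R) (P : set D)
    (p0 : T -> R) (dO : measure_display) (O : measurableType dO)
    (Pr : probability O R) (p : nat -> {RV Pr >-> D}) : Prop :=
  forall n, (0 < n)%N ->
  [/\ forall w, P (p n w),
      posterior_defined pi P p0 n
    & forall A : set D, measurable A -> A `<=` P ->
      Pr (p n @^-1` A) =
      iter_integral (fun Y : n.-tuple T =>
        weighted_likelihood pi Y A / weighted_likelihood pi Y P
        * (likelihood Y p0)%:E)].

(* [K] is required to be nonempty because ereal_sup set0 = -oo and
   -oo + +oo = -oo here, whereas K = set0 has to contribute +oo. *)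
Definition dsq_prior (t : R) (p0 : T -> R) (P : set D)
    (pi : probability D R) (n : nat) : \bar R :=
  ereal_inf [set x | exists K : set D,
    [/\ measurable K, K `<=` P, K !=set0
      & x = ereal_sup [set dsq t p0 q | q in K]
            - (n%:R^-1)%:E * lne (pi K)]].

(* The countable cover of [P] by the balls of radius [r] centred at the
   densities c j, for j in J. *)
Definition ball_cover (r : R) (P : set D) (J : set nat) (c : nat -> T -> R)
    : Prop :=
  (forall j, J j -> is_density (c j)) /\
  P `<=` \bigcup_(j in J) L1ball (c j) r.

Definition ball_radius (u : R) (n : nat) : R := (n%:R `^ (- u^-1))%R.

Definition covering_cond (u : R) (pim : probability D R) (Pm : set D)
    (n : nat) : \bar R :=
  ereal_inf [set x | exists (J : set nat) (c : nat -> T -> R),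
    ball_cover (ball_radius u n) Pm J c /\
    x = (\esum_(j in J) (pim (L1ball (c j) (ball_radius u n))) `^ u) `^ u^-1].

Definition covering_mix (u : R) (M : countType) (wt : M -> R)
    (pic : M -> probability D R) (Pm : M -> set D) (n : nat) : \bar R :=
  ereal_inf [set x | exists (J : M -> set nat) (c : M -> nat -> T -> R),
    (forall m, ball_cover (ball_radius u n) (Pm m) (J m) (c m)) /\
    x = (\esum_(m in [set: M]) \esum_(j in J m)
          ((wt m)%:E * pic m (L1ball (c m j) (ball_radius u n))) `^ u) `^ u^-1].

End densities.

(* Main.v *)
Require Import Defs.
From HB Require Import structures.
From mathcomp Require Import all_boot all_order all_algebra.
From mathcomp Require Import all_classical all_reals all_analysis.
From mathcomp Require Import measurable_realfun measurable_fun_approximation.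
From mathcomp Require Import ring lra.

Set Implicit Arguments.
Unset Strict Implicit.
Unset Printing Implicit Defensive.

Import Order.TTheory GRing.Theory Num.Theory.
Import numFieldNormedType.Exports.

Local Open Scope classical_set_scope.
Local Open Scope ring_scope.
Local Open Scope ereal_scope.

(** Let [rho f] be the affinity [\int p0^(1-u) f^u], so that
    [dsq (-u) p0 f = (1 - rho f) / u], and let [A] be the set of densities whose
    divergence exceeds the bound [eps].  The posterior mass of [A] is at most 1,
    hence at most its own power [al = u t / (u + t)], and Young's inequality
    separates the numerator, raised to the power [u], from the denominator,
    raised to the power [-t].

    Numerator: by subadditivity of [x^u] it suffices to treat a piece of [A] in an
    L1 ball of radius [n^(-1/u)].  Integrating out the observations one at a time,
    each step replaces a density of the piece by a mixture of densities of the
    piece.  Such a mixture is within [2 n^(-1/u)] of any density of the piece, so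
    its affinity is at most [1 - u eps + 2/n]; after [n] steps the error [2/n] only
    contributes the constant factor [exp 2].

    Denominator: it is bounded below by the mass of a set [K] that is almost optimal
    in the definition of [dsq_prior]; Jensen's inequality and Fubini's theorem
    reduce its moment of order [-t] to [\int p0^(1+t) f^(-t)] for [f] in [K].

    Together the posterior mass of [A] has expectation [O(n^(-2))], and the
    Borel-Cantelli lemma applies.  For the formula for the covering number of the
    mixture, covers of the models that are optimal up to a common factor [1 + e]
    are combined; this is possible as all the covering numbers are at least 1. *)

(** * Iterated integrals *)

Section iter_integral_theory.
Context {d : measure_display} {T : measurableType d} {R : realType}.
Variable mu : {sigma_finite_measure set T -> \bar R}.

(** The integral of a nonnegative function is the supremum over the simple functions below it, and
    that supremum is monotone; nonmeasurable integrands are covered as well. *)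
Lemma ge0_le_integralT d' (T' : measurableType d')
    (nu : {measure set T' -> \bar R}) (f g : T' -> \bar R) :
  (forall x, 0 <= f x) -> (forall x, f x <= g x) ->
  \int[nu]_x f x <= \int[nu]_x g x.
Proof.
move=> f0 fg; have g0 x : 0 <= g x by exact: le_trans (f0 x) (fg x).
rewrite !ge0_integralTE//; apply: ge_ereal_sup => _ [h hf <-].
by apply: ereal_sup_ubound; exists h => // x; exact: le_trans (hf x) (fg x).
Qed.

Lemma iter_integral_ge0 n (phi : n.-tuple T -> \bar R) :
  (forall Y, 0 <= phi Y) -> 0 <= iter_integral mu phi.
Proof.
elim: n phi => [|n IH] phi phi0 /=; first exact: phi0.
by apply: integral_ge0 => y _; apply: IH.
Qed.

Lemma le_iter_integral n (phi psi : n.-tuple T -> \bar R) :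
  (forall Y, 0 <= phi Y) -> (forall Y, phi Y <= psi Y) ->
  iter_integral mu phi <= iter_integral mu psi.
Proof.
elim: n phi psi => [|n IH] phi psi phi0 le /=; first exact: le.
apply: ge0_le_integralT => y; first exact: iter_integral_ge0.
exact: IH.
Qed.

Lemma eq_iter_integral n (phi psi : n.-tuple T -> \bar R) :
  phi =1 psi -> iter_integral mu phi = iter_integral mu psi.
Proof. by move=> /funext ->. Qed.

Lemma measurable_cons_param d' (X : measurableType d') n
    (phi : X -> n.+1.-tuple T -> \bar R) :
  measurable_fun [set: X * n.+1.-tuple T] (fun z => phi z.1 z.2) ->
  measurable_fun [set: (X * T) * n.-tuple T] (fun z =>
    phi z.1.1 [tuple of z.1.2 :: z.2]).
Proof.
move=> mphi.
have mc : measurable_fun [set: (X * T) * n.-tuple T] (fun z =>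
    (z.1.1, [tuple of z.1.2 :: z.2])).
  apply: measurable_fun_pair.
    exact: (measurableT_comp measurable_fst measurable_fst).
  apply: measurable_cons => //.
  exact: (measurableT_comp measurable_snd measurable_fst).
exact: (measurableT_comp mphi mc).
Qed.

(** Induction on [n] with the parameter space general: the first observation is integrated last, so
    it joins the parameter in [X * T], and Tonelli then integrates it out. *)
Lemma measurable_iter_integral d' (X : measurableType d') n
    (phi : X -> n.-tuple T -> \bar R) :
  (forall x Y, 0 <= phi x Y) ->
  measurable_fun [set: X * n.-tuple T] (fun z => phi z.1 z.2) ->
  measurable_fun setT (fun x => iter_integral mu (phi x)).
Proof.
elim: n d' X phi => [|n IH] d' X phi phi0 mphi /=.
  exact: (measurable_fun_pair1 [tuple] mphi).
have mF : measurable_fun [set: X * T] (fun z =>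
    iter_integral mu (fun ys : n.-tuple T => phi z.1 [tuple of z.2 :: ys])).
  apply: (IH _ _ (fun z ys => phi z.1 [tuple of z.2 :: ys])) => //.
  exact: measurable_cons_param.
apply: (@measurable_fun_fubini_tonelli_F _ _ _ _ _ mu _ mF).
by move=> z; apply: iter_integral_ge0.
Qed.

Lemma measurable_cons_pair n (phi : n.+1.-tuple T -> \bar R) :
  measurable_fun [set: n.+1.-tuple T] phi ->
  measurable_fun [set: T * n.-tuple T] (fun z => phi [tuple of z.1 :: z.2]).
Proof.
move=> mphi.
have mc : measurable_fun [set: T * n.-tuple T] (fun z => [tuple of z.1 :: z.2]).
  exact: measurable_cons.
exact: (measurableT_comp mphi mc).
Qed.

Lemma measurable_cons_tail n (phi : n.+1.-tuple T -> \bar R) y :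
  measurable_fun [set: n.+1.-tuple T] phi ->
  measurable_fun setT (fun ys : n.-tuple T => phi [tuple of y :: ys]).
Proof.
move=> mphi.
have mc : measurable_fun setT (fun ys : n.-tuple T => [tuple of y :: ys]).
  exact: measurable_cons.
exact: (measurableT_comp mphi mc).
Qed.

Lemma measurable_iter_integral_cons n (phi : n.+1.-tuple T -> \bar R) :
  (forall Y, 0 <= phi Y) -> measurable_fun [set: n.+1.-tuple T] phi ->
  measurable_fun setT (fun y =>
    iter_integral mu (fun ys : n.-tuple T => phi [tuple of y :: ys])).
Proof.
move=> phi0 mphi; apply: measurable_iter_integral => //.
exact: measurable_cons_pair.
Qed.

Lemma iter_integralD n (phi psi : n.-tuple T -> \bar R) :
  (forall Y, 0 <= phi Y) -> measurable_fun [set: n.-tuple T] phi ->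
  (forall Y, 0 <= psi Y) -> measurable_fun setT psi ->
  iter_integral mu (fun Y => phi Y + psi Y) =
  iter_integral mu phi + iter_integral mu psi.
Proof.
elim: n phi psi => [//|n IH] phi psi phi0 mphi psi0 mpsi /=.
rewrite -ge0_integralD//; last 4 first.
- by move=> y _; apply: iter_integral_ge0.
- exact: measurable_iter_integral_cons.
- by move=> y _; apply: iter_integral_ge0.
- exact: measurable_iter_integral_cons.
apply: eq_integral => y _.
by apply: (IH (fun ys => phi [tuple of y :: ys])
  (fun ys => psi [tuple of y :: ys])) => //; exact: measurable_cons_tail.
Qed.

Lemma iter_integralZl n (phi : n.-tuple T -> \bar R) (k : \bar R) : 0 <= k ->
  (forall Y, 0 <= phi Y) -> measurable_fun [set: n.-tuple T] phi ->
  iter_integral mu (fun Y => k * phi Y) = k * iter_integral mu phi.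
Proof.
move=> k0; elim: n phi => [//|n IH] phi phi0 mphi /=.
rewrite -ge0_integralZl//; last 2 first.
- exact: measurable_iter_integral_cons.
- by move=> y _; apply: iter_integral_ge0.
apply: eq_integral => y _.
by apply: (IH (fun ys => phi [tuple of y :: ys])) => //; exact: measurable_cons_tail.
Qed.

Lemma iter_integral_nneseries n (phi : (n.-tuple T -> \bar R)^nat) :
  (forall i Y, 0 <= phi i Y) -> (forall i, measurable_fun setT (phi i)) ->
  iter_integral mu (fun Y => \sum_(i <oo) phi i Y) =
  \sum_(i <oo) iter_integral mu (phi i).
Proof.
elim: n phi => [//|n IH] phi phi0 mphi /=.
rewrite -integral_nneseries//; last 2 first.
- by move=> i; apply: measurable_iter_integral_cons.
- by move=> i y _; apply: iter_integral_ge0.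
apply: eq_integral => y _.
by apply: (IH (fun i ys => phi i [tuple of y :: ys])) => // i;
  exact: measurable_cons_tail.
Qed.

End iter_integral_theory.

(** * Subadditivity of powers and Young's inequality *)

Section powers.
Context {R : realType}.
Implicit Types (a b u t : R) (x y : \bar R).

Lemma le_poweR u x y : (0 <= u)%R -> 0 <= x -> x <= y -> x `^ u <= y `^ u.
Proof.
move=> u0 x0 xy; apply: gt0_ler_poweR => //; rewrite in_itv/= leey andbT//.
exact: le_trans xy.
Qed.

(** The shares [a / (a + b)] and [b / (a + b)] lie in [0, 1] and so are at most their [u]-th powers;
    they add up to 1. *)
Lemma powR_subadditive u a b : (0 < u)%R -> (u <= 1)%R ->
  (0 <= a)%R -> (0 <= b)%R -> ((a + b) `^ u <= a `^ u + b `^ u)%R.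
Proof.
move=> u0 u1 a0 b0.
have [->|an0] := eqVneq a 0%R; first by rewrite add0r powR0 ?gt_eqF// add0r.
have s0 : (0 < a + b)%R by rewrite ltr_pwDl// lt_neqAle eq_sym an0.
have ineq c : (0 <= c)%R -> (c <= a + b)%R ->
    ((a + b) `^ u * (c / (a + b)) <= c `^ u)%R.
  move=> c0 cs; have [->|cn0] := eqVneq c 0%R.
    by rewrite mul0r mulr0 powR_ge0.
  have cs0 : (0 < c / (a + b))%R by rewrite divr_gt0// lt_neqAle eq_sym cn0.
  have -> : (c `^ u = (a + b) `^ u * (c / (a + b)) `^ u)%R.
    by rewrite -powRM ?(ltW s0) ?(ltW cs0)// mulrC divfK ?gt_eqF.
  by rewrite ler_wpM2l ?powR_ge0// ger1_powR// cs0 ler_pdivrMr// mul1r.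
have := lerD (ineq a a0 _) (ineq b b0 _); rewrite -mulrDr -mulrDl mulfV ?gt_eqF//.
by rewrite mulr1; apply; rewrite ?lerDl ?lerDr.
Qed.

Lemma poweR_subadditive u x y : (0 < u)%R -> (u <= 1)%R ->
  0 <= x -> 0 <= y -> (x + y) `^ u <= x `^ u + y `^ u.
Proof.
move=> u0 u1; move: x y => [x| |] [y| |]//= x0 y0; rewrite ?gt_eqF//=.
by rewrite lee_fin powR_subadditive.
Qed.

(** For finite sums this is an induction. For the limit, both sides are raised to the power [u^-1],
    so that each partial sum is bounded separately and monotonicity of powers suffices in place of
    continuity. *)
Lemma poweR_nneseries_le u (x : (\bar R)^nat) : (0 < u)%R -> (u <= 1)%R ->
  (forall i, 0 <= x i) -> (\sum_(i <oo) x i) `^ u <= \sum_(i <oo) (x i) `^ u.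
Proof.
move=> u0 u1 x0.
have fin n : (\sum_(0 <= i < n) x i) `^ u <= \sum_(0 <= i < n) (x i) `^ u.
  elim: n => [|n IH]; first by rewrite !big_nil poweR0r// gt_eqF.
  rewrite !big_nat_recr//=; apply: le_trans (poweR_subadditive _ _ _ _) _ => //.
    by apply: sume_ge0.
  exact: leeD.
have u'0 : (0 <= u^-1)%R by rewrite invr_ge0 ltW.
rewrite -[leRHS](@poweRe1 R)//; last by apply: nneseries_ge0 => *; exact: poweR_ge0.
rewrite -(@mulVf _ u) ?gt_eqF// poweRrM; apply: le_poweR => //.
- exact: ltW.
- exact: nneseries_ge0.
apply: lime_le; first exact: is_cvg_nneseries.
apply: nearW => n.
rewrite -[leLHS](@poweRe1 R) ?sume_ge0// -(@mulfV _ u) ?gt_eqF// poweRrM.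
apply: le_poweR => //; first exact: poweR_ge0.
apply: le_trans (fin n) _.
by apply: nneseries_lim_ge => *; exact: poweR_ge0.
Qed.

(** Young's inequality for the conjugate exponents [(1 - u)^-1] and [u^-1], that is, the weighted
    inequality of arithmetic and geometric means. *)
Lemma young_powR u a b : (0 < u)%R -> (u < 1)%R -> (0 <= a)%R -> (0 <= b)%R ->
  (a `^ (1 - u) * b `^ u <= (1 - u) * a + u * b)%R.
Proof.
move=> u0 u1 a0 b0; have u1' : (0 < 1 - u)%R by rewrite subr_gt0.
have := @conjugate_powR R (a `^ (1 - u))%R (b `^ u)%R (1 - u)^-1%R u^-1%R
  (powR_ge0 _ _) (powR_ge0 _ _).
rewrite !invr_gt0 !invrK -!powRrM !divff ?gt_eqF// !powRr1//.
by rewrite (mulrC a) (mulrC b); apply => //; rewrite subrK.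
Qed.

End powers.

(** * The power [u] of the numerator *)

Section mixture.
Context {d d' : measure_display} {T : measurableType d} {X : measurableType d'}
  {R : realType}.
Variable mu : {sigma_finite_measure set T -> \bar R}.
Variable nu : {sigma_finite_measure set X -> \bar R}.
Variable F : X -> T -> R.
Hypothesis F0 : forall x y, (0 <= F x y)%R.
Hypothesis mF : measurable_fun [set: X * T] (fun z => F z.1 z.2).

Lemma likelihood_cons n (y : T) (ys : n.-tuple T) (f : T -> R) :
  likelihood [tuple of y :: ys] f = (f y * likelihood ys f)%R.
Proof.
rewrite /likelihood big_ord_recl tnth0; congr (_ * _)%R.
by apply: eq_bigr => i _; rewrite tnthS.
Qed.

Lemma likelihood_ge0 n (Y : n.-tuple T) (f : T -> R) :
  (forall y, (0 <= f y)%R) -> (0 <= likelihood Y f)%R.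
Proof. by move=> f0; apply: prodr_ge0 => i _. Qed.

Lemma measurable_likelihood n :
  measurable_fun [set: X * n.-tuple T] (fun z => likelihood z.2 (F z.1)).
Proof.
rewrite /likelihood; apply: measurable_prod => i _.
have mc : measurable_fun [set: X * n.-tuple T] (fun z => (z.1, tnth z.2 i)).
  apply: measurable_fun_pair => //.
  exact: (measurableT_comp (measurable_tnth i) measurable_snd).
exact: (measurableT_comp mF mc).
Qed.

Lemma measurable_likelihood1 n (f : T -> R) : measurable_fun setT f ->
  measurable_fun [set: n.-tuple T] (fun Y => likelihood Y f).
Proof.
move=> mf; apply: measurable_prod => i _.
exact: (measurableT_comp mf (measurable_tnth i)).
Qed.

Lemma measurable_wlik n (w : X -> \bar R) : measurable_fun setT w ->
  measurable_fun [set: X * n.-tuple T]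
    (fun z => w z.1 * (likelihood z.2 (F z.1))%:E).
Proof.
move=> mw; apply: emeasurable_funM.
  exact: (measurableT_comp mw measurable_fst).
by apply/measurable_EFinP; exact: measurable_likelihood.
Qed.

Lemma measurable_mix n (w : X -> \bar R) :
  measurable_fun setT w -> (forall x, 0 <= w x) ->
  measurable_fun [set: n.-tuple T]
    (fun Y => \int[nu]_x (w x * (likelihood Y (F x))%:E)).
Proof.
move=> mw w0.
apply: (measurable_fun_fubini_tonelli_G
  (fun z : X * n.-tuple T => w z.1 * (likelihood z.2 (F z.1))%:E)).
  exact: measurable_wlik.
by move=> z; rewrite mule_ge0// lee_fin likelihood_ge0.
Qed.

Lemma measurable_wF (w : X -> \bar R) (G : X -> T -> R) :
  measurable_fun setT w -> measurable_fun [set: X * T] (fun z => G z.1 z.2) ->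
  measurable_fun [set: X * T] (fun z => w z.1 * (G z.1 z.2)%:E).
Proof.
move=> mw mG; apply: emeasurable_funM.
  exact: (measurableT_comp mw measurable_fst).
exact/measurable_EFinP.
Qed.

Lemma measurable_kernel x : measurable_fun setT (F x).
Proof. exact: (measurable_fun_pair2 x mF). Qed.

Lemma measurable_wF1 (w : X -> \bar R) y : measurable_fun setT w ->
  measurable_fun setT (fun x => w x * (F x y)%:E).
Proof. by move=> mw; exact: (measurable_fun_pair1 y (measurable_wF mw mF)). Qed.

Section hellinger.
Variables (p0 : T -> R) (u E rho theta : R) (S : set X).
Hypotheses (mp0 : measurable_fun setT p0) (p00 : forall y, (0 <= p0 y)%R)
  (p01 : \int[mu]_y (p0 y)%:E = 1).
Hypotheses (u0 : (0 < u)%R) (u1 : (u < 1)%R) (E0 : (0 < E)%R).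
Hypothesis diam : forall x x', S x -> S x' ->
  \int[mu]_y `|F x y - F x' y|%:E <= E%:E.
Hypothesis affinity : forall x, S x ->
  \int[mu]_y (p0 y `^ (1 - u) * F x y `^ u)%:E <= rho%:E.
Hypotheses (theta0 : (0 < theta)%R) (thetaE : (rho + E `^ u <= theta)%R).

Let mpow s (f : T -> R) : measurable_fun setT f ->
  measurable_fun setT (fun y => (f y `^ s)%R).
Proof. by move=> mf; exact: (measurableT_comp (measurable_powR s)). Qed.

(* Every [F x] with [x] in [S] is within [E] of a fixed [F x0], so the
   normalised mixture is, too: replacing the mixture by [F x0] costs [E `^ u]. *)
Lemma hellinger_step (w : X -> \bar R) :
  measurable_fun setT w -> (forall x, 0 <= w x) -> (forall x, ~ S x -> w x = 0) ->
  \int[mu]_y ((p0 y `^ (1 - u))%:E * (\int[nu]_x (w x * (F x y)%:E)) `^ u)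
  <= theta%:E * (\int[nu]_x w x) `^ u.
Proof.
move=> mw w0 wS; set W := \int[nu]_x w x.
have W0 : 0 <= W by apply: integral_ge0.
have [WE|Wn0] := eqVneq W 0.
  rewrite WE poweR0r ?gt_eqF// mule0 integral0_eq// => y _.
  suff -> : \int[nu]_x (w x * (F x y)%:E) = 0.
    by rewrite poweR0r ?gt_eqF// mule0.
  have ae0 : ae_eq nu setT w (cst 0).
    apply/ae_eq_integral_abs => //; rewrite -[RHS]WE.
    by apply: eq_integral => x _; rewrite gee0_abs.
  rewrite (ge0_ae_eq_integral (g := cst 0)) ?integral0//.
  - exact: measurable_wF1.
  - by move=> x _; rewrite mule_ge0// lee_fin.
  - by apply: filterS ae0 => x /= h xT; rewrite h// mul0e.
have Wp : 0 < W by rewrite lt0e Wn0.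
have [Wy|Wf] := eqVneq W +oo.
  by rewrite Wy poweRyr ?gt_eqF// gt0_muley ?lte_fin// leey.
have [x0 Sx0] : exists x, S x.
  apply: contrapT => /forallNP noS.
  by move/eqP: Wn0; apply; apply: integral0_eq => x _; apply: wS.
have {Wf Wp} [W' W'0 WE] : exists2 r : R, (0 < r)%R & W = r%:E.
  by move: W Wf Wp W0 {Wn0} => [r| |]//= _; rewrite lte_fin => r0 _; exists r.
(* [e] bounds the distance of the unnormalised mixture from [W] times the density [F x0]; by [diam]
   and Tonelli its integral is at most [E * W']. *)
pose e y := \int[nu]_x (w x * `|F x y - F x0 y|%:E).
have mdiff : measurable_fun [set: X * T] (fun z => `|F z.1 z.2 - F x0 z.2|%R).
  apply: measurableT_comp => //; apply: measurable_funB => //.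
  exact: (measurableT_comp (measurable_kernel x0) measurable_snd).
have mwd : measurable_fun [set: X * T] (fun z => w z.1 * `|F z.1 z.2 - F x0 z.2|%:E).
  exact: (measurable_wF (G := fun x y => `|F x y - F x0 y|%R)).
have wd0 (z : X * T) : 0 <= w z.1 * `|F z.1 z.2 - F x0 z.2|%:E.
  by rewrite mule_ge0// lee_fin.
have me : measurable_fun setT e.
  exact: (measurable_fun_fubini_tonelli_G _ mwd wd0).
have e0 y : 0 <= e y by apply: integral_ge0 => x _; exact: (wd0 (x, y)).
have inte : \int[mu]_y e y <= (E * W')%:E.
  rewrite -(fubini_tonelli _ mwd wd0).
  apply: (@le_trans _ _ (\int[nu]_x (E%:E * w x))); last first.
    by rewrite ge0_integralZl_EFin ?(ltW E0)// -/W WE EFinM.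
  apply: ge0_le_integralT => x.
    by apply: integral_ge0 => y _; exact: (wd0 (x, y)).
  rewrite /= ge0_integralZl//; last first.
    apply/measurable_EFinP; apply: measurableT_comp => //.
    by apply: measurable_funB; exact: measurable_kernel.
  have [Sx|nSx] := pselect (S x); last by rewrite wS// mul0e mule0.
  by rewrite muleC lee_wpmul2r// diam.
have gle y : \int[nu]_x (w x * (F x y)%:E) <= W * (F x0 y)%:E + e y.
  rewrite /W muleC -ge0_integralZl//; last by rewrite lee_fin.
  rewrite -ge0_integralD//; last 4 first.
  - by move=> x _; rewrite mule_ge0// lee_fin.
  - exact: measurable_funeM.
  - by move=> x _; exact: (wd0 (x, y)).
  - exact: (measurable_fun_pair1 y mwd).
  apply: ge0_le_integralT => x; first by rewrite mule_ge0// lee_fin.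
  rewrite (muleC (F x0 y)%:E) -ge0_muleDr ?lee_fin// lee_wpmul2l//.
  by rewrite -EFinD lee_fin -lerBlDl ler_norm.
have EW0 : (0 < E * W')%R by rewrite mulr_gt0.
set E' := (E * W')%R in EW0 inte.
have mp0u : measurable_fun setT (fun y => (p0 y `^ (1 - u))%R) by exact: mpow.
pose h1 y := ((W' `^ u)%:E * (p0 y `^ (1 - u) * F x0 y `^ u)%:E).
(* Young's inequality for the error term, with [e] divided by [E'] so that its integral is at most
   1; hence [h2] integrates to at most the power [u] of [E']. *)
pose h2 y := ((E' `^ u)%:E * ((1 - u)%:E * (p0 y)%:E + (u / E')%:E * e y)).
have mh1 : measurable_fun setT h1.
  apply: measurable_funeM; apply/measurable_EFinP.
  by apply: measurable_funM => //; apply: mpow; exact: measurable_kernel.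
have mh2a : measurable_fun setT (fun y => (1 - u)%:E * (p0 y)%:E).
  by apply: measurable_funeM; exact/measurable_EFinP.
have mh2b : measurable_fun setT (fun y => (u / E')%:E * e y).
  exact: measurable_funeM.
have uE0 : (0 <= u / E')%R by rewrite divr_ge0// ltW.
have u10 : (0 <= 1 - u)%R by rewrite subr_ge0 ltW.
have h2a0 y : 0 <= (1 - u)%:E * (p0 y)%:E by rewrite mule_ge0// lee_fin.
have h2b0 y : 0 <= (u / E')%:E * e y by rewrite mule_ge0// lee_fin.
have mh2 : measurable_fun setT h2.
  by apply: measurable_funeM; exact: emeasurable_funD.
have h10 y : 0 <= h1 y by rewrite mule_ge0// lee_fin ?mulr_ge0 ?powR_ge0.
have h20 y : 0 <= h2 y by rewrite mule_ge0 ?lee_fin ?powR_ge0// adde_ge0.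
apply: (@le_trans _ _ (\int[mu]_y (h1 y + h2 y))).
  apply: ge0_le_integralT => y.
    by rewrite mule_ge0// ?lee_fin ?powR_ge0// poweR_ge0.
  apply: (@le_trans _ _ ((p0 y `^ (1 - u))%:E *
      ((W * (F x0 y)%:E) `^ u + (e y) `^ u))).
    rewrite lee_wpmul2l ?lee_fin ?powR_ge0//.
    apply: le_trans (poweR_subadditive u0 (ltW u1) _ _) => //.
      apply: le_poweR; first exact: ltW.
      - by apply: integral_ge0 => x _; rewrite mule_ge0// lee_fin.
      - exact: gle.
    by rewrite mule_ge0// lee_fin.
  rewrite ge0_muleDr ?poweR_ge0//; apply: leeD.
    rewrite WE -(EFinM W') poweR_EFin /h1 -!EFinM lee_fin powRM ?(ltW W'0)//.
    by rewrite mulrCA.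
  rewrite /h2; move: (e y) (e0 y) => [r| |]// r0; last first.
    rewrite gt0_muley ?lte_fin ?divr_gt0// addey//.
    by rewrite gt0_muley ?lte_fin ?powR_gt0// leey.
  rewrite lee_fin in r0.
  suff : (p0 y `^ (1 - u) * r `^ u <=
      E' `^ u * ((1 - u) * p0 y + u / E' * r))%R by rewrite -lee_fin.
  have -> : (r `^ u = E' `^ u * (r / E') `^ u)%R.
    by rewrite -powRM ?(ltW EW0) ?divr_ge0 ?(ltW EW0)// mulrC divfK ?gt_eqF.
  rewrite mulrCA ler_wpM2l ?powR_ge0// mulrAC -mulrA.
  by apply: young_powR => //; rewrite divr_ge0// ltW.
rewrite ge0_integralD// ge0_integralZl//; last 3 first.
- apply/measurable_EFinP.
  by apply: measurable_funM => //; apply: mpow; exact: measurable_kernel.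
- by move=> y _; rewrite lee_fin mulr_ge0 ?powR_ge0.
- by rewrite lee_fin powR_ge0.
rewrite ge0_integralZl//; last 3 first.
- exact: emeasurable_funD.
- by move=> y _; rewrite adde_ge0.
- by rewrite lee_fin powR_ge0.
rewrite ge0_integralD// ge0_integralZl//; [|exact/measurable_EFinP|by move=> *; rewrite lee_fin].
rewrite p01 mule1 ge0_integralZl//.
apply: (@le_trans _ _ ((W' `^ u)%:E * rho%:E + (E' `^ u)%:E * 1)).
  apply: leeD; first by rewrite lee_wpmul2l ?lee_fin ?powR_ge0// affinity.
  rewrite lee_wpmul2l ?lee_fin ?powR_ge0//.
  apply: (@le_trans _ _ ((1 - u)%:E + (u / E')%:E * E'%:E)).
    by rewrite leeD2l// lee_wpmul2l// lee_fin.
  by rewrite -EFinM divfK ?gt_eqF// -EFinD subrK.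
rewrite mule1 WE -EFinM -EFinD poweR_EFin -EFinM lee_fin.
have -> : (W' `^ u * rho + E' `^ u = (rho + E `^ u) * W' `^ u)%R.
  by rewrite /E' powRM ?(ltW E0) ?(ltW W'0)// mulrDl (mulrC rho).
by rewrite ler_wpM2r ?powR_ge0.
Qed.

(** Induction with the weight general: fixing the first observation [y] replaces [w x] by
    [w x * F x y], which still vanishes outside [S]. The induction hypothesis integrates out the
    other observations, and [hellinger_step] integrates out [y] at the cost of one factor
    [theta]. *)
Lemma hellinger_iter n (w : X -> \bar R) :
  measurable_fun setT w -> (forall x, 0 <= w x) -> (forall x, ~ S x -> w x = 0) ->
  iter_integral mu (fun Y : n.-tuple T => (likelihood Y p0 `^ (1 - u))%:E *
    (\int[nu]_x (w x * (likelihood Y (F x))%:E)) `^ u)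
  <= (theta ^+ n)%:E * (\int[nu]_x w x) `^ u.
Proof.
elim: n w => [|n IH] w mw w0 wS /=.
  rewrite expr0 mul1e /likelihood big_ord0 powR1 mul1e.
  by under eq_integral do rewrite big_ord0 mule1.
apply: (@le_trans _ _ (\int[mu]_y ((theta ^+ n)%:E *
    ((p0 y `^ (1 - u))%:E * (\int[nu]_x (w x * (F x y)%:E)) `^ u)))).
  apply: ge0_le_integralT => y.
    apply: iter_integral_ge0 => Y.
    by rewrite mule_ge0// ?lee_fin ?powR_ge0// poweR_ge0.
  rewrite (@eq_iter_integral _ _ _ _ _ _ (fun Y : n.-tuple T =>
      (p0 y `^ (1 - u))%:E * ((likelihood Y p0 `^ (1 - u))%:E *
      (\int[nu]_x ((w x * (F x y)%:E) * (likelihood Y (F x))%:E)) `^ u))).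
    have mw' : measurable_fun setT (fun x => w x * (F x y)%:E).
      exact: measurable_wF1.
    rewrite iter_integralZl ?lee_fin ?powR_ge0//; last 2 first.
    - by move=> Y; rewrite mule_ge0 ?lee_fin ?powR_ge0 ?poweR_ge0.
    - apply: emeasurable_funM.
        apply/measurable_EFinP; apply: (measurableT_comp (measurable_powR _)).
        exact: measurable_likelihood1.
      apply: (measurableT_comp (measurable_poweR u)).
      by apply: measurable_mix => // x; rewrite mule_ge0// lee_fin.
    rewrite muleCA lee_wpmul2l ?lee_fin ?powR_ge0//; apply: IH => // x.
      by rewrite mule_ge0// lee_fin.
    by move=> nSx; rewrite wS// mul0e.
  move=> Y; rewrite likelihood_cons powRM ?likelihood_ge0// EFinM -muleA.
  congr (_ * (_ * _ `^ u)); apply: eq_integral => x _.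
  by rewrite likelihood_cons EFinM muleA.
rewrite ge0_integralZl//; last 3 first.
- apply: emeasurable_funM; first by apply/measurable_EFinP; exact: mpow.
  apply: (measurableT_comp (measurable_poweR u)).
  apply: (measurable_fun_fubini_tonelli_G _ (measurable_wF mw mF)) => z.
  by rewrite mule_ge0// lee_fin.
- by move=> y _; rewrite mule_ge0 ?lee_fin ?powR_ge0 ?poweR_ge0.
- by rewrite lee_fin exprn_ge0// ltW.
rewrite exprSr EFinM -muleA lee_wpmul2l ?lee_fin ?exprn_ge0 ?(ltW theta0)//.
exact: hellinger_step.
Qed.

End hellinger.
End mixture.

(** * The moment of order [-t] of the denominator *)

Section inverse_moment.
Context {R : realType}.
Implicit Types (a b t : R).

(* The value of [a `^ (1 + t) * b `^ (- t)], with [0] for [a = 0] and [+oo] for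
   [a != 0] and [b = 0]. *)
Definition invmom t a b : \bar R :=
  if a == 0%R then 0 else if b == 0%R then +oo else (a `^ (1 + t) * b `^ (- t))%:E.

Lemma invmom_ge0 t a b : 0 <= invmom t a b.
Proof.
rewrite /invmom; case: ifP => // _; case: ifP => // _.
by rewrite lee_fin mulr_ge0 ?powR_ge0.
Qed.

Lemma invmom11 t : invmom t 1 1 = 1.
Proof. by rewrite /invmom oner_eq0 !powR1 mul1r. Qed.

(** This makes the moment of a likelihood the product of the moments of its factors. The conventions
    agree because [0 * +oo = 0]: a vanishing true density wins over a vanishing denominator. *)
Lemma invmomM t a b a' b' : (0 <= a)%R -> (0 <= b)%R -> (0 <= a')%R -> (0 <= b')%R ->
  invmom t (a * a') (b * b') = invmom t a b * invmom t a' b'.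
Proof.
move=> a0 b0 a'0 b'0; rewrite /invmom !mulf_eq0.
case: (eqVneq a 0%R) => [_|an0] /=; first by rewrite mul0e.
case: (eqVneq a' 0%R) => [_|a'n0] /=; first by rewrite mule0.
have p x y : (0 < x -> 0 < y -> 0 < x `^ (1 + t) * y `^ (- t))%R.
  by move=> x0 y0; rewrite mulr_gt0 ?powR_gt0.
have {}an0 : (0 < a)%R by rewrite lt_neqAle eq_sym an0.
have {}a'n0 : (0 < a')%R by rewrite lt_neqAle eq_sym a'n0.
case: (eqVneq b 0%R) => [_|bn0] /=; case: (eqVneq b' 0%R) => [_|b'n0] /=.
- by rewrite mulyy.
- by rewrite gt0_mulye// lte_fin p// lt_neqAle eq_sym b'n0.
- by rewrite gt0_muley// lte_fin p// lt_neqAle eq_sym bn0.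
- by rewrite -EFinM !powRM ?(ltW an0) ?(ltW a'n0)// mulrACA.
Qed.

Lemma measurable_invmom d (T : measurableType d) t (f g : T -> R) :
  measurable_fun setT f -> measurable_fun setT g ->
  measurable_fun setT (fun x => invmom t (f x) (g x)).
Proof.
move=> mf mg; apply: measurable_fun_ifT => //.
  exact: (@measurable_fun_eqr _ _ _ _ f (cst 0%R)).
apply: measurable_fun_ifT => //.
  exact: (@measurable_fun_eqr _ _ _ _ g (cst 0%R)).
apply/measurable_EFinP; apply: measurable_funM.
  exact: (measurableT_comp (measurable_powR _)).
exact: (measurableT_comp (measurable_powR _)).
Qed.

(* The tangent line of the convex function [b |-> b `^ (- t)] at [m]. *)
Lemma powRN_tangent t m b : (0 < t)%R -> (0 < m)%R -> (0 < b)%R ->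
  ((1 + t) * m `^ (- t) <= b `^ (- t) + t * m `^ (- t) / m * b)%R.
Proof.
move=> t0 m0 b0; set s := (b / m)%R.
have s0 : (0 < s)%R by rewrite divr_gt0.
have -> : (b `^ (- t) = m `^ (- t) * s `^ (- t))%R.
  by rewrite -powRM ?ltW// /s mulrC divfK ?gt_eqF.
have -> : (t * m `^ (- t) / m * b = m `^ (- t) * (t * s))%R by rewrite /s; ring.
rewrite -mulrDr mulrC ler_wpM2l ?powR_ge0//.
(* Both estimates are [1 + z <= expR z], once with [z = - t * ln s] and once in its logarithmic
   form. *)
have h1 : (1 - t * ln s <= s `^ (- t))%R.
  rewrite /powR gt_eqF//; apply: le_trans (expR_ge1Dx _); by rewrite mulNr.
have h2 : (ln s <= s - 1)%R.
  by have := @le_ln1Dx R (s - 1)%R; rewrite subrKC; apply; rewrite ltrBrDl subrr.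
apply: le_trans (lerD h1 (lexx (t * s)%R)).
have := ler_wpM2l (ltW t0) h2; lra.
Qed.

End inverse_moment.

Section inverse_moment_mixture.
Context {d d' : measure_display} {T : measurableType d} {X : measurableType d'}
  {R : realType}.
Variable mu : {sigma_finite_measure set T -> \bar R}.
Variable nu : {sigma_finite_measure set X -> \bar R}.

(** Jensen's inequality for the weight [w] normalised by its mass [k]: the tangent line at
    [m = l / k] is integrated against [w]. Since that line decreases, the mean of [g] may be
    replaced by its upper bound [m]. *)
Lemma invmom_jensen (t a k l : R) (w : X -> \bar R) (g : X -> R) :
  (0 < t)%R -> (0 <= a)%R -> (0 < k)%R -> (0 < l)%R ->
  measurable_fun setT w -> (forall x, 0 <= w x) ->
  measurable_fun setT g -> (forall x, (0 <= g x)%R) ->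
  \int[nu]_x w x = k%:E -> \int[nu]_x (w x * (g x)%:E) <= l%:E ->
  (a `^ (1 + t) * l `^ (- t) * k `^ (1 + t))%:E
  <= \int[nu]_x (w x * invmom t a (g x)).
Proof.
move=> t0 a0 k0 l0 mw w0 mg g0 wk wl.
have [->|an0] := eqVneq a 0%R.
  rewrite powR0 ?gt_eqF ?addr_gt0// !mul0r.
  by apply: integral_ge0 => x _; rewrite mule_ge0// invmom_ge0.
have {}an0 : (0 < a)%R by rewrite lt_neqAle eq_sym an0.
set m := (l / k)%R; have m0 : (0 < m)%R by rewrite divr_gt0.
have A0 : (0 <= a `^ (1 + t))%R by exact: powR_ge0.
set A := (a `^ (1 + t))%R in A0 *.
set c := (A * (t * m `^ (- t) / m))%R.
have c0 : (0 <= c)%R by rewrite mulr_ge0// divr_ge0 ?(ltW m0)// mulr_ge0 ?powR_ge0 ?(ltW t0).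
(* Where [g] vanishes the right side is infinite; elsewhere this is the tangent inequality
   multiplied by [A]. *)
have point x : (A * ((1 + t) * m `^ (- t)))%:E <= invmom t a (g x) + (c * g x)%:E.
  rewrite /invmom gt_eqF//; case: eqVneq => [_|gn0]; first by rewrite leey.
  rewrite -EFinD lee_fin /c -mulrA -mulrDr ler_wpM2l//.
  by apply: powRN_tangent => //; rewrite lt_neqAle eq_sym gn0 g0.
have mi : measurable_fun setT (fun x => w x * invmom t a (g x)).
  by apply: emeasurable_funM => //; exact: measurable_invmom.
have mwg : measurable_fun setT (fun x => w x * (g x)%:E).
  by apply: emeasurable_funM => //; exact/measurable_EFinP.
have i0 x : 0 <= w x * invmom t a (g x) by rewrite mule_ge0// invmom_ge0.
have wg0 x : 0 <= w x * (g x)%:E by rewrite mule_ge0// lee_fin.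
have B0 : (0 <= A * ((1 + t) * m `^ (- t)))%R.
  by rewrite mulr_ge0// mulr_ge0 ?powR_ge0// addr_ge0 ?(ltW t0).
have : (A * ((1 + t) * m `^ (- t)))%:E * k%:E <=
    \int[nu]_x (w x * invmom t a (g x)) + c%:E * l%:E.
  apply: (@le_trans _ _ (\int[nu]_x (w x * invmom t a (g x)) +
      c%:E * \int[nu]_x (w x * (g x)%:E))); last first.
    by rewrite leeD2l// lee_wpmul2l// lee_fin.
  rewrite -wk -!ge0_integralZl// -ge0_integralD//; last 2 first.
  - by move=> x _; rewrite mule_ge0// lee_fin.
  - exact: measurable_funeM.
  apply: ge0_le_integralT => x; first by rewrite mule_ge0// lee_fin.
  rewrite muleCA -EFinM -ge0_muleDr ?invmom_ge0 ?lee_fin ?(mulr_ge0 c0)//.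
  by rewrite muleC lee_wpmul2l.
rewrite -!EFinM -leeBlDr// -EFinB; apply: le_trans; rewrite lee_fin.
clear point; have km : (l = m * k)%R by rewrite /m divfK ?gt_eqF.
have -> : (A * ((1 + t) * m `^ (- t)) * k - c * l = A * (m `^ (- t) * k))%R.
  rewrite km /c -/m; clearbody m A; field; by rewrite gt_eqF.
suff -> : (A * l `^ (- t) * k `^ (1 + t) = A * (m `^ (- t) * k))%R by [].
rewrite km powRM ?(ltW m0) ?(ltW k0)// -mulrA -mulrA; congr (_ * (_ * _))%R.
by rewrite -powRD ?(gt_eqF k0) ?implybT// addrCA addNr addr0 powRr1 ?ltW.
Qed.

Variable F : X -> T -> R.
Hypothesis F0 : forall x y, (0 <= F x y)%R.
Hypothesis mF : measurable_fun [set: X * T] (fun z => F z.1 z.2).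
Variables (p0 : T -> R) (t theta : R) (S : set X).
Hypotheses (mp0 : measurable_fun setT p0) (p00 : forall y, (0 <= p0 y)%R).
Hypothesis theta0 : (0 <= theta)%R.
Hypothesis moment : forall x, S x ->
  \int[mu]_y invmom t (p0 y) (F x y) <= theta%:E.

Lemma measurable_invmom_likelihood n (w : X -> \bar R) : measurable_fun setT w ->
  measurable_fun [set: X * n.-tuple T] (fun z =>
    w z.1 * invmom t (likelihood z.2 p0) (likelihood z.2 (F z.1))).
Proof.
move=> mw; apply: emeasurable_funM.
  exact: (measurableT_comp mw measurable_fst).
apply: measurable_invmom; last exact: measurable_likelihood.
exact: (measurableT_comp (measurable_likelihood1 mp0) measurable_snd).
Qed.

Lemma measurable_invmom_mix n (w : X -> \bar R) :
  measurable_fun setT w -> (forall x, 0 <= w x) ->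
  measurable_fun [set: n.-tuple T] (fun Y =>
    \int[nu]_x (w x * invmom t (likelihood Y p0) (likelihood Y (F x)))).
Proof.
move=> mw w0; apply: (measurable_fun_fubini_tonelli_G _
  (measurable_invmom_likelihood (n := n) mw)).
by move=> z; rewrite mule_ge0// invmom_ge0.
Qed.

(** The same induction as for the numerator, the weight absorbing the factor of the first
    observation. The bound is linear in [w], so the step is just Tonelli and the one-observation
    bound [moment]. *)
Lemma invmom_iter n (w : X -> \bar R) :
  measurable_fun setT w -> (forall x, 0 <= w x) -> (forall x, ~ S x -> w x = 0) ->
  iter_integral mu (fun Y : n.-tuple T =>
    \int[nu]_x (w x * invmom t (likelihood Y p0) (likelihood Y (F x))))
  <= (theta ^+ n)%:E * \int[nu]_x w x.
Proof.
elim: n w => [|n IH] w mw w0 wS /=.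
  rewrite expr0 mul1e /likelihood; under eq_integral do
    rewrite !big_ord0 invmom11 mule1.
  by [].
have mi : measurable_fun [set: X * T] (fun z => w z.1 * invmom t (p0 z.2) (F z.1 z.2)).
  apply: emeasurable_funM; first exact: (measurableT_comp mw measurable_fst).
  apply: measurable_invmom => //.
  exact: (measurableT_comp mp0 measurable_snd).
have i0 (z : X * T) : 0 <= w z.1 * invmom t (p0 z.2) (F z.1 z.2).
  by rewrite mule_ge0// invmom_ge0.
apply: (@le_trans _ _ (\int[mu]_y ((theta ^+ n)%:E *
    \int[nu]_x (w x * invmom t (p0 y) (F x y))))).
  apply: ge0_le_integralT => y.
    apply: iter_integral_ge0 => Y.
    by apply: integral_ge0 => x _; rewrite mule_ge0// invmom_ge0.
  rewrite (@eq_iter_integral _ _ _ _ _ _ (fun Y : n.-tuple T =>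
      \int[nu]_x ((w x * invmom t (p0 y) (F x y)) *
        invmom t (likelihood Y p0) (likelihood Y (F x))))).
    apply: IH => [|x|x nSx].
    - exact: (measurable_fun_pair1 y mi).
    - exact: (i0 (x, y)).
    - by rewrite wS// mul0e.
  move=> Y; apply: eq_integral => x _.
  by rewrite !likelihood_cons invmomM ?likelihood_ge0// muleA.
rewrite ge0_integralZl//; last 3 first.
- exact: (measurable_fun_fubini_tonelli_G _ mi i0).
- by move=> y _; apply: integral_ge0 => x _; exact: (i0 (x, y)).
- by rewrite lee_fin exprn_ge0.
rewrite exprSr EFinM -muleA lee_wpmul2l ?lee_fin ?exprn_ge0//.
rewrite -(fubini_tonelli _ mi i0) -ge0_integralZl// ?lee_fin//.
apply: ge0_le_integralT => x.
  by apply: integral_ge0 => y _; exact: (i0 (x, y)).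
rewrite /= ge0_integralZl//; last 2 first.
- by apply: measurable_invmom => //; exact: (measurable_fun_pair2 x mF).
- by move=> y _; exact: invmom_ge0.
have [Sx|nSx] := pselect (S x); last by rewrite wS// mul0e mule0.
by rewrite muleC lee_wpmul2r// moment.
Qed.

End inverse_moment_mixture.

(** * Expected posterior mass of a set covered by small pieces *)

Section posterior_bound.
Context {R : realType}.

(* The exponents solve [s1 + s2 = 1] and [s1 * u = s2 * t], so that the powers of
   [a] on the right multiply up to [a]. *)
Lemma posterior_young (u t a x l S V s1 s2 : R) :
  (0 < u)%R -> (u < 1)%R -> (0 < t)%R -> (0 <= a)%R -> (0 <= x)%R -> (0 < l)%R ->
  (x <= l)%R -> (0 < S)%R -> (0 < V)%R ->
  s1 = (t / (u + t))%R -> s2 = (u / (u + t))%R ->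
  (x / l * a <= S `^ s1 * V `^ s2 *
    (s1 / S * (a `^ (1 - u) * x `^ u) + s2 / V * (a `^ (1 + t) * l `^ (- t))))%R.
Proof.
move=> u0 u1 t0 a0 x0 l0 xl S0 V0 s1d s2d.
have ut0 : (0 < u + t)%R by rewrite addr_gt0.
have s10 : (0 < s1)%R by rewrite s1d divr_gt0.
have s20 : (0 < s2)%R by rewrite s2d divr_gt0.
have s1E : (s1 = 1 - s2)%R by rewrite s1d s2d; field; rewrite gt_eqF.
have s21 : (s2 < 1)%R by rewrite -subr_gt0 -s1E.
have us : (u * s1 = t * s2)%R by rewrite s1d s2d; field; rewrite gt_eqF.
set U := (a `^ (1 - u) * x `^ u)%R; set W := (a `^ (1 + t) * l `^ (- t))%R.
have U0 : (0 <= U)%R by rewrite mulr_ge0 ?powR_ge0.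
have W0 : (0 <= W)%R by rewrite mulr_ge0 ?powR_ge0.
(* The middle term equals [a] times the power [u * s1] of [x / l]. It is bounded above by Young's
   inequality for [U / S] and [W / V]; it dominates the left side because [x / l <= 1] and
   [u * s1 <= 1]. *)
apply: (@le_trans _ _ (U `^ s1 * W `^ s2)%R); last first.
  have -> : (U `^ s1 * W `^ s2 =
      S `^ s1 * V `^ s2 * ((U / S) `^ s1 * (W / V) `^ s2))%R.
    have e1 : (U `^ s1 = S `^ s1 * (U / S) `^ s1)%R.
      by rewrite -powRM ?divr_ge0 ?(ltW S0)// mulrC divfK ?gt_eqF.
    have e2 : (W `^ s2 = V `^ s2 * (W / V) `^ s2)%R.
      by rewrite -powRM ?divr_ge0 ?(ltW V0)// mulrC divfK ?gt_eqF.
    by rewrite e1 e2 mulrACA.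
  rewrite ler_wpM2l ?mulr_ge0 ?powR_ge0//.
  have := @young_powR R s2 (U / S) (W / V) s20 s21.
  rewrite -s1E => /(_ _ _)/le_trans; apply; rewrite ?divr_ge0 ?(ltW S0) ?(ltW V0)//.
  by rewrite (mulrC U) (mulrC W) !mulrA.
have [->|an0] := eqVneq a 0%R; first by rewrite mulr0 mulr_ge0 ?powR_ge0.
have {}an0 : (0 < a)%R by rewrite lt_neqAle eq_sym an0.
have -> : (U `^ s1 * W `^ s2 = (x / l) `^ (u * s1) * a)%R.
  rewrite /U /W !powRM ?powR_ge0// ?invr_ge0 ?(ltW l0)// -!powRrM.
  rewrite -(powR_inv1 (ltW l0)) -(powRrM l) mulrACA.
  rewrite -powRD ?(gt_eqF an0) ?implybT//.
  have -> : ((1 - u) * s1 + (1 + t) * s2 = 1)%R.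
    by rewrite mulrBl mulrDl us s1E !mul1r; lra.
  by rewrite powRr1// mulN1r mulNr us mulrC.
rewrite ler_wpM2r//.
have [->|xn0] := eqVneq x 0%R; first by rewrite mul0r powR_ge0.
have xl0 : (0 < x / l)%R by rewrite divr_gt0// lt_neqAle eq_sym xn0.
rewrite ger1_powR ?xl0 ?ler_pdivrMr ?mul1r//.
apply: mulr_ile1 => //; first exact: ltW.
- exact: ltW.
- exact: ltW.
- by rewrite s1E gerBl ltW.
Qed.

Lemma integral_indicE d (X : measurableType d) (nu : {measure set X -> \bar R})
    (S : set X) (f : X -> \bar R) :
  \int[nu]_(x in S) f x = \int[nu]_x ((\1_S x)%:E * f x).
Proof.
rewrite integral_mkcond; apply: eq_integral => x _.
by rewrite patchE indicE; case: ifPn => _; rewrite ?mul1e ?mul0e.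
Qed.

Lemma nneseries_term_le (f : (\bar R)^nat) i :
  (forall j, 0 <= f j) -> f i <= \sum_(j <oo) f j.
Proof.
move=> f0; apply: le_trans (nneseries_lim_ge i.+1 _) => [|*]; last exact: f0.
by rewrite big_nat_recr//= leeDr// sume_ge0.
Qed.

(** The indicator of [A] is at most the sum of the indicators of the [S i], and the integral
    commutes with that sum. *)
Lemma ge0_integral_cover_le d (X : measurableType d) (nu : {measure set X -> \bar R})
    (A : set X) (S : (set X)^nat) (f : X -> \bar R) :
  (forall i, measurable (S i)) -> A `<=` \bigcup_i S i ->
  measurable_fun setT f -> (forall x, 0 <= f x) ->
  \int[nu]_(x in A) f x <= \sum_(i <oo) \int[nu]_(x in S i) f x.
Proof.
move=> mS AS mf f0.
under eq_eseriesr do rewrite integral_indicE.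
rewrite integral_indicE -integral_nneseries//; last 2 first.
- move=> i; apply: emeasurable_funM => //.
  by apply/measurable_EFinP; exact: measurable_indic.
- by move=> i x _; rewrite mule_ge0// lee_fin.
apply: ge0_le_integralT => x; first by rewrite mule_ge0// lee_fin.
have t0 j : 0 <= (\1_(S j) x)%:E * f x by rewrite mule_ge0// lee_fin.
have [/AS[i _ Six]|nAx] := pselect (A x).
  apply: le_trans (nneseries_term_le i t0); rewrite (indicE _ (S i)) mem_set// mul1e.
  by rewrite -[leRHS]mul1e lee_wpmul2r// lee_fin indicE; case: (_ \in _).
by rewrite indicE memNset// mul0e; apply: nneseries_ge0.
Qed.

Context {d d' : measure_display} {T : measurableType d} {X : measurableType d'}.
Variable mu : {sigma_finite_measure set T -> \bar R}.
Variable nu : {sigma_finite_measure set X -> \bar R}.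
Variable F : X -> T -> R.
Hypothesis F0 : forall x y, (0 <= F x y)%R.
Hypothesis mF : measurable_fun [set: X * T] (fun z => F z.1 z.2).
Variables (p0 : T -> R) (u t E rho theta thetaK k B : R).
Hypotheses (mp0 : measurable_fun setT p0) (p00 : forall y, (0 <= p0 y)%R)
  (p01 : \int[mu]_y (p0 y)%:E = 1).
Hypotheses (u0 : (0 < u)%R) (u1 : (u < 1)%R) (t0 : (0 < t)%R) (E0 : (0 < E)%R).
Variables (A K P : set X) (S : (set X)^nat).
Hypotheses (mK : measurable K) (mP : measurable P) (mA : measurable A)
  (mS : forall i, measurable (S i)).
Hypotheses (AP : A `<=` P) (KP : K `<=` P) (AS : A `<=` \bigcup_i S i).
Hypothesis diam : forall i x x', S i x -> S i x' ->
  \int[mu]_y `|F x y - F x' y|%:E <= E%:E.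
Hypothesis affinity : forall i x, S i x ->
  \int[mu]_y (p0 y `^ (1 - u) * F x y `^ u)%:E <= rho%:E.
Hypotheses (theta0 : (0 < theta)%R) (thetaE : (rho + E `^ u <= theta)%R).
Hypothesis thetaK0 : (0 < thetaK)%R.
Hypothesis moment : forall x, K x ->
  \int[mu]_y invmom t (p0 y) (F x y) <= thetaK%:E.
Hypotheses (k0 : (0 < k)%R) (nuK : nu K = k%:E).
Hypotheses (B0 : (0 < B)%R) (nuS : \sum_(i <oo) (nu (S i)) `^ u <= B%:E).

Let lik n (Y : n.-tuple T) (C : set X) := \int[nu]_(x in C) (likelihood Y (F x))%:E.

(** For each sample, [posterior_young] bounds the posterior mass by a linear combination of [T1],
    coming from the numerator, and [T2], coming from the denominator. The iterated integral is then
    taken term by term. *)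
Lemma posterior_mass_le n :
  iter_integral mu (fun Y : n.-tuple T =>
    lik Y A / lik Y P * (likelihood Y p0)%:E)
  <= ((theta ^+ n * B) `^ (t / (u + t)) *
      (thetaK ^+ n * k `^ (- t)) `^ (u / (u + t)))%:E.
Proof.
set c1 := (t / (u + t))%R; set c2 := (u / (u + t))%R.
(* [SS] and [V] are the bounds for the expected numerator and denominator terms; normalising by them
   makes the two contributions [c1] and [c2], which add up to 1. *)
set SS := (theta ^+ n * B)%R; set V := (thetaK ^+ n * k `^ (- t))%R.
have SS0 : (0 < SS)%R by rewrite mulr_gt0 ?exprn_gt0.
have V0 : (0 < V)%R by rewrite mulr_gt0 ?exprn_gt0 ?powR_gt0.
have ut0 : (0 < u + t)%R by rewrite addr_gt0.
have c10 : (0 < c1)%R by rewrite divr_gt0.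
have c20 : (0 < c2)%R by rewrite divr_gt0.
set C := (SS `^ c1 * V `^ c2)%R.
have C0 : (0 <= C)%R by rewrite mulr_ge0 ?powR_ge0.
have mlik (Y : n.-tuple T) : measurable_fun setT (fun x => (likelihood Y (F x))%:E).
  by apply/measurable_EFinP; exact: (measurable_fun_pair1 Y (measurable_likelihood (n := n) mF)).
have lik0 (Y : n.-tuple T) x : 0 <= (likelihood Y (F x))%:E.
  by rewrite lee_fin likelihood_ge0.
have likC0 Y D : 0 <= lik (n := n) Y D by apply: integral_ge0.
have lik_le Y D D' : measurable D -> measurable D' -> D `<=` D' ->
    lik (n := n) Y D <= lik Y D'.
  by move=> mD mD' DD'; apply: ge0_subset_integral => //; exact: measurable_funTS.
pose wgt (D : set X) x : \bar R := (\1_D x)%:E.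
have wgt0 D x : 0 <= wgt D x by rewrite lee_fin.
have mwgt D : measurable D -> measurable_fun setT (wgt D).
  by move=> mD; apply/measurable_EFinP; exact: measurable_indic.
have wgtD D x : ~ D x -> wgt D x = 0 by move=> Dx; rewrite /wgt indicE memNset.
have int_wgt D : measurable D -> \int[nu]_x wgt D x = nu D.
  by move=> mD; rewrite /wgt integral_indic// setIT.
have likE Y D : lik (n := n) Y D = \int[nu]_x (wgt D x * (likelihood Y (F x))%:E).
  exact: integral_indicE.
pose T1 i (Y : n.-tuple T) := (likelihood Y p0 `^ (1 - u))%:E * (lik Y (S i)) `^ u.
pose T2 (Y : n.-tuple T) :=
  \int[nu]_x (wgt K x * invmom t (likelihood Y p0) (likelihood Y (F x))).
have T10 i Y : 0 <= T1 i Y by rewrite mule_ge0 ?lee_fin ?powR_ge0 ?poweR_ge0.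
have T20 Y : 0 <= T2 Y.
  by apply: integral_ge0 => x _; rewrite mule_ge0// invmom_ge0.
have mT1 i : measurable_fun setT (T1 i).
  apply: emeasurable_funM.
    apply/measurable_EFinP; apply: (measurableT_comp (measurable_powR _)).
    exact: measurable_likelihood1.
  apply: (measurableT_comp (measurable_poweR u)).
  under eq_fun do rewrite likE.
  by apply: measurable_mix => //; exact: mwgt.
have mT2 : measurable_fun setT T2.
  by apply: measurable_invmom_mix => //; exact: mwgt.
have iT1 : \sum_(i <oo) iter_integral mu (T1 i) <= SS%:E.
  apply: (@le_trans _ _ (\sum_(i <oo) ((theta ^+ n)%:E * (nu (S i)) `^ u))).
    apply: lee_nneseries => i _ ; first by move=> _; exact: iter_integral_ge0.
    rewrite -int_wgt// /T1.
    under eq_iter_integral do rewrite likE.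
    apply: (hellinger_iter nu F0 mF mp0 p00 p01 u0 u1 E0 (@diam i) (@affinity i)
      theta0 thetaE) => //; [exact: mwgt|exact: wgtD].
  rewrite nneseriesZl; last by move=> i _; exact: poweR_ge0.
  by rewrite EFinM lee_wpmul2l// lee_fin exprn_ge0// ltW.
have iT2 : iter_integral mu T2 <= (thetaK ^+ n * k)%:E.
  rewrite EFinM -nuK -int_wgt//.
  apply: (invmom_iter nu F0 mF mp0 p00 (ltW thetaK0) moment) => //.
    exact: mwgt.
  exact: wgtD.
(* The power of [k] in [b2] cancels the mass factor that Jensen's inequality produces for the weight
   concentrated on [K]. *)
set b1 := (c1 / SS)%R; set b2 := (c2 / V * k `^ (- (1 + t)))%R.
have b10 : (0 <= b1)%R by rewrite divr_ge0// ltW.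
have b20 : (0 <= b2)%R.
  by rewrite mulr_ge0 ?powR_ge0// divr_ge0 ?(ltW c20) ?(ltW V0).
have mG1 : measurable_fun setT (fun Y => \sum_(i <oo) T1 i Y).
  exact: ge0_emeasurable_sum.
have G10 Y : 0 <= \sum_(i <oo) T1 i Y by exact: nneseries_ge0.
apply: (@le_trans _ _ (iter_integral mu (fun Y : n.-tuple T =>
    C%:E * (b1%:E * \sum_(i <oo) T1 i Y + b2%:E * T2 Y)))).
  apply: le_iter_integral => Y.
    by rewrite mule_ge0 ?lee_fin ?likelihood_ge0// mule_ge0// inve_ge0.
  have G0 : 0 <= C%:E * (b1%:E * \sum_(i <oo) T1 i Y + b2%:E * T2 Y).
    by rewrite mule_ge0 ?lee_fin// adde_ge0// mule_ge0.
  have := lik_le Y _ _ mA mP AP; have := lik_le Y _ _ mK mP KP.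
  have := likC0 Y A; have := likC0 Y P.
  (* Both degenerate denominators give ratio 0: the inverse of [+oo] is 0, and a zero denominator
     forces a zero numerator since [A] lies in [P]. *)
  case El : (lik Y P) => [l| |]//; last first.
    by rewrite invey mule0 mul0e.
  rewrite lee_fin le_eqVlt => /predU1P[<-|l0].
    move=> A0 _ A0'; have /eqP -> : lik Y A == 0 by rewrite eq_le A0 A0'.
    by rewrite !mul0e.
  case Ex : (lik Y A) => [x| |]//; rewrite !lee_fin => x0 Kl xl.
  have a0 : (0 <= likelihood Y p0)%R by rewrite likelihood_ge0.
  rewrite inver gt_eqF// -!EFinM.
  apply: (@le_trans _ _ (C * (c1 / SS * (likelihood Y p0 `^ (1 - u) * x `^ u) +
      c2 / V * (likelihood Y p0 `^ (1 + t) * l `^ (- t))))%:E).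
    by rewrite lee_fin; apply: posterior_young.
  rewrite EFinM lee_wpmul2l ?lee_fin// EFinD; apply: leeD.
    rewrite EFinM lee_wpmul2l ?lee_fin// nneseriesZl; last first.
      by move=> i _; exact: poweR_ge0.
    rewrite EFinM lee_wpmul2l ?lee_fin ?powR_ge0//.
    (* The numerator is at most the sum over the pieces, and subadditivity moves the power [u]
       inside that sum. *)
    apply: le_trans (poweR_nneseries_le u0 (ltW u1) _) => //.
    rewrite -poweR_EFin -Ex; apply: le_poweR => //; first exact: ltW.
    exact: ge0_integral_cover_le.
  (* The full denominator [l] bounds the mass over [K] from above, which is all that Jensen's
     inequality requires of it. *)
  have := @invmom_jensen _ _ _ nu t (likelihood Y p0) k l (wgt K)
    (fun x => likelihood Y (F x)) t0 a0 k0 l0 (mwgt _ mK) (wgt0 _).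
  rewrite int_wgt// -likE => /(_ _ _ nuK Kl) J.
  apply: (@le_trans _ _ (b2%:E * (likelihood Y p0 `^ (1 + t) * l `^ (- t) *
      k `^ (1 + t))%:E)).
    rewrite -EFinM lee_fin /b2 le_eqVlt; apply/orP; left; apply/eqP.
    rewrite (powRN k) -[RHS]mulrA; congr (_ * _)%R.
    by rewrite mulrCA mulVf ?mulr1// gt_eqF// powR_gt0.
  rewrite lee_wpmul2l ?lee_fin//; apply: J.
  - by apply/measurable_EFinP; exact: mlik.
  - by move=> z; rewrite likelihood_ge0.
rewrite iter_integralZl ?lee_fin//; last 2 first.
- by move=> Y; rewrite adde_ge0// mule_ge0// lee_fin.
- by apply: emeasurable_funD; exact: measurable_funeM.
rewrite iter_integralD//; last 4 first.
- by move=> Y; rewrite mule_ge0// lee_fin.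
- exact: measurable_funeM.
- by move=> Y; rewrite mule_ge0// lee_fin.
- exact: measurable_funeM.
rewrite !iter_integralZl ?lee_fin// iter_integral_nneseries//.
rewrite -[leRHS]mule1 lee_wpmul2l ?lee_fin//.
apply: (@le_trans _ _ (b1%:E * SS%:E + b2%:E * (thetaK ^+ n * k)%:E)).
  by apply: leeD; rewrite lee_wpmul2l ?lee_fin.
rewrite -!EFinM -EFinD lee_fin /b1 divfK ?gt_eqF//.
have -> : (b2 * (thetaK ^+ n * k) = c2)%R.
  rewrite /b2 /V opprD powRD ?(gt_eqF k0) ?implybT// powR_inv1 ?(ltW k0)//.
  by field; rewrite ?gt_eqF ?powR_gt0 ?exprn_gt0.
by rewrite /c1 /c2 -mulrDl addrC divff// gt_eqF.
Qed.

End posterior_bound.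

(** * The divergence as an affinity and as an inverse moment *)

Section divergence.
Context {d : measure_display} {T : measurableType d} {R : realType}.
Variable mu : {sigma_finite_measure set T -> \bar R}.
Implicit Types p q : T -> R.

(** By Young's inequality the affinity is at most 1, hence finite, so the integral of the difference
    splits into the affinity minus 1. *)
Lemma affinity_dsq p q (u : R) : (0 < u)%R -> (u < 1)%R ->
  is_density mu p -> is_density mu q ->
  exists2 r : R, \int[mu]_y (p y `^ (1 - u) * q y `^ u)%:E = r%:E
    & dsq mu (- u) p q = (u^-1 * (1 - r))%:E.
Proof.
move=> u0 u1 [mp p0 p1] [mq q0 q1].
have mg : measurable_fun setT (fun y => (p y `^ (1 - u) * q y `^ u)%:E).
  apply/measurable_EFinP; apply: measurable_funM;
    exact: (measurableT_comp (measurable_powR _)).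
have g0 y : 0 <= (p y `^ (1 - u) * q y `^ u)%:E.
  by rewrite lee_fin mulr_ge0 ?powR_ge0.
have mpE : measurable_fun setT (fun y => (p y)%:E) by exact/measurable_EFinP.
have mqE : measurable_fun setT (fun y => (q y)%:E) by exact/measurable_EFinP.
have u10 : (0 <= 1 - u)%R by rewrite subr_ge0 ltW.
have g1 : \int[mu]_y (p y `^ (1 - u) * q y `^ u)%:E <= 1.
  apply: (@le_trans _ _ (\int[mu]_y ((1 - u)%:E * (p y)%:E + u%:E * (q y)%:E))).
    apply: ge0_le_integralT => y //.
    by rewrite -!EFinM -EFinD lee_fin young_powR.
  rewrite ge0_integralD//; last 4 first.
  - by move=> y _; rewrite mule_ge0// lee_fin.
  - exact: measurable_funeM.
  - by move=> y _; rewrite mule_ge0// lee_fin// ltW.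
  - exact: measurable_funeM.
  rewrite !ge0_integralZl// ?lee_fin// ?(ltW u0)//; last 2 first.
  - by move=> y _; rewrite lee_fin.
  - by move=> y _; rewrite lee_fin.
  by rewrite p1 q1 !mule1 -EFinD subrK.
have gf : \int[mu]_y (p y `^ (1 - u) * q y `^ u)%:E \is a fin_num.
  by rewrite ge0_fin_numE ?(le_lt_trans g1) ?ltry// integral_ge0.
exists (fine (\int[mu]_y (p y `^ (1 - u) * q y `^ u)%:E)); first by rewrite fineK.
have intp : mu.-integrable setT (EFin \o p).
  apply/integrableP; split => //; under eq_integral do rewrite /= ger0_norm//.
  by rewrite p1 ltry.
have intg : mu.-integrable setT (EFin \o (fun y => p y `^ (1 - u) * q y `^ u)%R).
  apply/integrableP; split => //.
  under eq_integral do rewrite /= ger0_norm ?mulr_ge0 ?powR_ge0//.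
  by rewrite (le_lt_trans g1)// ltry.
rewrite /dsq (eq_integral (fun y => (p y `^ (1 - u) * q y `^ u - p y)%:E)); last first.
  (* A negative exponent never selects the infinite branch; where [q y] is 0 and [p y] is not, real
     division by 0 yields the correct value [- p y]. *)
  move=> y _; rewrite /dsq_integrand ltNge oppr_le0 ltW//=; congr EFin.
  have [->|pn0] := eqVneq (p y) 0%R.
    by rewrite powR0 ?subr_eq0 ?gt_eqF// !mul0r subrr.
  have pp : (0 < p y)%R by rewrite lt_neqAle eq_sym pn0 p0.
  have [->|qn0] := eqVneq (q y) 0%R.
    by rewrite invr0 mulr0 !powR0 ?oppr_eq0 ?gt_eqF// mulr0 !sub0r mulrN1.
  have qp : (0 < q y)%R by rewrite lt_neqAle eq_sym qn0 q0.
  rewrite mulrBr mulr1 powRM ?invr_ge0// -(powR_inv1 (ltW qp)) -powRrM mulN1r opprK.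
  by rewrite mulrA -{1}(powRr1 (ltW pp)) -powRD// pn0 implybT.
rewrite (_ : (fun y => _) = (fun y => (p y `^ (1 - u) * q y `^ u)%:E - (p y)%:E))//.
rewrite integralB_EFin// p1 -(fineK gf) invrN -EFinB -EFinM; congr EFin.
by rewrite mulNr -mulrN opprB.
Qed.

Lemma invmom_dsq_integrand p q (t : R) y : (0 < t)%R ->
  (0 <= p y)%R -> (0 <= q y)%R ->
  dsq_integrand t p q y + (p y)%:E = invmom t (p y) (q y).
Proof.
move=> t0 p0 q0; rewrite /dsq_integrand /invmom t0/=.
have [->|pn0] /= := eqVneq (p y) 0%R; first by rewrite mul0r adde0.
have [_|qn0] //= := eqVneq (q y) 0%R.
have pp : (0 < p y)%R by rewrite lt_neqAle eq_sym pn0.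
have qp : (0 < q y)%R by rewrite lt_neqAle eq_sym qn0.
rewrite -EFinD mulrBr mulr1 subrK powRM ?invr_ge0// -(powR_inv1 q0) -powRrM mulN1r.
by rewrite mulrA -{1}(powRr1 p0) -powRD// pn0 implybT.
Qed.

(** The integral may be infinite, so it is not split directly: the negative part of [D] is dominated
    by [p] and has a finite integral, and the identity is proved with this part added to both
    sides. *)
Lemma invmom_dsq p q (t : R) : (0 < t)%R -> is_density mu p -> is_density mu q ->
  \int[mu]_y invmom t (p y) (q y) = 1 + t%:E * dsq mu t p q.
Proof.
move=> t0 [mp p0 p1] [mq q0 q1].
pose D := dsq_integrand t p q.
have DE y : D y = invmom t (p y) (q y) - (p y)%:E.
  by rewrite -invmom_dsq_integrand// addeK.
have mpE : measurable_fun setT (fun y => (p y)%:E) by exact/measurable_EFinP.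
have mi : measurable_fun setT (fun y => invmom t (p y) (q y)).
  exact: measurable_invmom.
have mD : measurable_fun setT D.
  by rewrite (funext DE); exact: emeasurable_funB.
have Dneg y : D^\- y <= (p y)%:E.
  rewrite funenegE ge_max lee_fin p0 andbT DE oppeB ?fin_num_adde_defl//.
  by rewrite -[leRHS]add0e leeD2r// oppe_le0 invmom_ge0.
have Df : \int[mu]_y D^\- y \is a fin_num.
  rewrite ge0_fin_numE; last exact: integral_ge0.
  apply: (@le_lt_trans _ _ 1); last exact: ltry.
  by rewrite -p1; exact: ge0_le_integralT.
have eq : \int[mu]_y D^\+ y + 1 = \int[mu]_y invmom t (p y) (q y) + \int[mu]_y D^\- y.
  rewrite -p1 -!ge0_integralD//.
  - apply: eq_integral => y _.
    have Dy : D y = D^\+ y - D^\- y by rewrite {1}(funeposneg D).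
    rewrite -invmom_dsq_integrand// -/(D y) Dy [RHS]addeAC subeK//.
    by rewrite ge0_fin_numE// (le_lt_trans (Dneg y))// ltry.
  - by move=> y _; exact: invmom_ge0.
  - exact: measurable_funeneg.
  - exact: measurable_funepos.
  - by move=> y _; rewrite lee_fin.
rewrite /dsq muleA -EFinM divff ?gt_eqF// mul1e.
have -> : \int[mu]_y dsq_integrand t p q y = \int[mu]_y D^\+ y - \int[mu]_y D^\- y.
  exact: integralE.
by rewrite addeA [1 + _]addeC eq addeK.
Qed.

(** A crude bound, from nonnegativity of the inverse moment, that excludes the value [-oo] in
    [dsq_prior]. *)
Lemma dsq_ge p q (t : R) : (0 < t)%R -> is_density mu p -> is_density mu q ->
  (- t^-1)%:E <= dsq mu t p q.
Proof.
move=> t0 dp dq; have := invmom_dsq t0 dp dq.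
have : 0 <= \int[mu]_y invmom t (p y) (q y).
  by apply: integral_ge0 => y _; exact: invmom_ge0.
move=> /[swap] ->; case: (dsq mu t p q) => [r| |].
- rewrite !lee_fin => h; rewrite -(ler_pM2l t0) mulrN mulfV ?gt_eqF//.
  by rewrite -subr_ge0 opprK addrC.
- by rewrite leey.
- by rewrite gt0_muleNy ?lte_fin.
Qed.

Lemma invmom_le_expR p q (t c : R) : (0 < t)%R ->
  is_density mu p -> is_density mu q -> dsq mu t p q <= c%:E ->
  \int[mu]_y invmom t (p y) (q y) <= (expR (t * c))%:E.
Proof.
move=> t0 dp dq le; rewrite invmom_dsq//.
apply: (@le_trans _ _ (1 + t%:E * c%:E)); last by rewrite lee_fin expR_ge1Dx.
by rewrite leeD2l// lee_wpmul2l// lee_fin ltW.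
Qed.

End divergence.

(** * Covering numbers *)

Section covering.
Context {d : measure_display} {T : measurableType d} {R : realType}.
Variable mu : {sigma_finite_measure set T -> \bar R}.

Lemma esum_ge_term (I : choiceType) (S : set I) (a : I -> \bar R) i :
  S i -> (forall j, 0 <= a j) -> a i <= \esum_(j in S) a j.
Proof.
move=> Si a0; apply: esum_ge; exists [set i]; last by rewrite fsbig_set1.
by split => [|_ ->//]; exact: finite_set1.
Qed.

Lemma esumZl_le (I : choiceType) (S : set I) (a : I -> \bar R) (c : R) :
  (0 <= c)%R -> (forall j, 0 <= a j) ->
  \esum_(j in S) (c%:E * a j) <= c%:E * \esum_(j in S) a j.
Proof.
move=> c0 a0; apply: ge_ereal_sup => _ [X SX <-].
rewrite -ge0_mule_fsumr// lee_wpmul2l// ?lee_fin//.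
by apply: esum_ge; exists X.
Qed.

Lemma esumZl (I : choiceType) (S : set I) (a : I -> \bar R) (c : R) :
  (0 < c)%R -> (forall j, 0 <= a j) ->
  \esum_(j in S) (c%:E * a j) = c%:E * \esum_(j in S) a j.
Proof.
move=> c0 a0; apply/eqP; rewrite eq_le esumZl_le ?(ltW c0)//=.
rewrite -lee_pdivlMl//; apply: le_trans (esumZl_le _ _ _); last 2 first.
- by rewrite invr_ge0 ltW.
- by move=> j; rewrite mule_ge0// lee_fin ltW.
apply: le_esum => j _.
by rewrite muleA -EFinM mulVf ?gt_eqF// mul1e.
Qed.

Lemma poweRVK (u : R) (x : \bar R) : (0 < u)%R -> 0 <= x -> (x `^ u^-1) `^ u = x.
Proof. by move=> u0 x0; rewrite -poweRrM mulVf ?gt_eqF// poweRe1. Qed.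

Lemma poweRKV (u : R) (x : \bar R) : (0 < u)%R -> 0 <= x -> (x `^ u) `^ u^-1 = x.
Proof. by move=> u0 x0; rewrite -poweRrM mulfV ?gt_eqF// poweRe1. Qed.

Lemma le1_poweR (u : R) (x : \bar R) : (0 < u)%R -> 1 <= x -> 1 <= x `^ u.
Proof.
move=> u0 x1; rewrite -(poweR1r u); apply: le_poweR => //; exact: ltW.
Qed.

Lemma ge1_poweR (u : R) (x : \bar R) : (u <= 1)%R -> 0 <= x -> x <= 1 ->
  x <= x `^ u.
Proof.
move=> u1; case: x => [r| |]//; rewrite !lee_fin => r0 r1.
have [->|rn0] := eqVneq r 0%R; first by rewrite powR_ge0.
by rewrite ger1_powR// r1 andbT lt_neqAle eq_sym rn0.
Qed.

Variable G : set (set (T -> R)).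
Local Notation D := (g_sigma_algebraType G).
Hypothesis hball : forall (c : T -> R) (r : R), is_density mu c ->
  measurable (L1ball mu c r : set D).

Variable u : R.
Hypotheses (u0 : (0 < u)%R) (u1 : (u <= 1)%R).

Lemma le_poweR_prob (pim : probability D R) (A : set D) : measurable A ->
  pim A <= (pim A) `^ u.
Proof.
by move=> mA; apply: ge1_poweR => //; exact: probability_le1.
Qed.

(** Countable subadditivity bounds the total mass 1 by the sum of the ball probabilities, and a
    probability is at most its power [u]. *)
Lemma ball_cover_sum_ge1 (pim : probability D R) (Pm : set D) r J c :
  measurable Pm -> pim Pm = 1 -> ball_cover mu r Pm J c ->
  1 <= \esum_(j in J) (pim (L1ball mu (c j) r)) `^ u.
Proof.
move=> mPm pPm [dens cov].
(* Centres outside [J] may fail to be densities, and their balls may fail to be measurable; they are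
   replaced by the empty set. *)
pose F j : set D := if j \in J then L1ball mu (c j) r else set0.
have mF j : measurable (F j).
  rewrite /F; case: ifPn => [/set_mem Jj|_]; last exact: measurable0.
  by apply: hball; exact: dens.
have PF : Pm `<=` \bigcup_j F j.
  by move=> f /cov[j Jj fj]; exists j => //; rewrite /F mem_set.
have le : pim Pm <= \sum_(j <oo) pim (F j) by exact: measure_sigma_subadditive.
rewrite -pPm; apply: le_trans le _.
rewrite nneseries_esumT// [leRHS]esum_mkcond; apply: le_esum => j _.
rewrite /F; case: ifPn => [/set_mem Jj|_]; last by rewrite measure0.
by apply: le_poweR_prob; apply: hball; exact: dens.
Qed.

Lemma covering_cond_ge1 (pim : probability D R) (Pm : set D) n :
  measurable Pm -> pim Pm = 1 -> 1 <= covering_cond mu u pim Pm n.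
Proof.
move=> mPm pPm; apply: le_ereal_inf_tmp => _ [J [c [cov ->]]].
apply: le1_poweR; first by rewrite invr_gt0.
exact: (ball_cover_sum_ge1 mPm pPm cov).
Qed.

Variables (M : countType) (wt : M -> R) (pic : M -> probability D R)
  (Pm : M -> set D).
Hypotheses (hwt : forall m, (0 < wt m)%R)
  (mPm : forall m, measurable (Pm m)) (hPm1 : forall m, pic m (Pm m) = 1).

Let cov n m := covering_cond mu u (pic m) (Pm m) n.

Let cov1 n m : 1 <= cov n m.
Proof. exact: covering_cond_ge1. Qed.

Let cov0 n m : 0 <= cov n m.
Proof. exact: le_trans (cov1 n m). Qed.

Let wcov0 n m : 0 <= ((wt m)%:E * cov n m) `^ u.
Proof. exact: poweR_ge0. Qed.

(** Pulls the weight out of the inner sum, leaving the quantity whose infimum over covers is the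
    covering number of model [m]. *)
Lemma esum_weighted (m : M) (J : set nat) (b : nat -> \bar R) :
  (forall j, 0 <= b j) ->
  \esum_(j in J) ((wt m)%:E * b j) `^ u =
  ((wt m)%:E * (\esum_(j in J) (b j) `^ u) `^ u^-1) `^ u.
Proof.
move=> b0; have w0 : 0 <= (wt m)%:E by rewrite lee_fin ltW.
under eq_esum do rewrite poweRM//.
rewrite poweRM ?poweR_ge0// poweRVK//; last first.
  by apply: esum_ge0 => j _; exact: poweR_ge0.
by rewrite esumZl ?powR_gt0// => j; exact: poweR_ge0.
Qed.

(** Each cover of the mixture restricts to a cover of every model, which gives one inequality term
    by term. For the other, if the right side is finite, covers optimal up to the factor [1 + e] are
    chosen in all models at once, and this common factor comes out of the sum. *)
Lemma covering_mixE n : covering_mix mu u wt pic Pm n =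
  (\esum_(m in [set: M]) ((wt m)%:E * cov n m) `^ u) `^ u^-1.
Proof.
have uV0 : (0 <= u^-1)%R by rewrite invr_ge0 ltW.
set rhs := RHS.
have rhs0 : 0 <= rhs by exact: poweR_ge0.
apply/eqP; rewrite eq_le; apply/andP; split; last first.
  apply: le_ereal_inf_tmp => _ [J [c [hc ->]]].
  apply: le_poweR => //; first exact: esum_ge0.
  apply: le_esum => m _; rewrite esum_weighted//.
  apply: le_poweR; [exact: ltW|by rewrite mule_ge0// lee_fin ltW|].
  rewrite lee_wpmul2l ?lee_fin ?(ltW (hwt m))//.
  by apply: ereal_inf_lbound; exists (J m), (c m).
have [->|rhsf] := eqVneq rhs +oo; first by rewrite leey.
have wcovf m : ((wt m)%:E * cov n m) `^ u != +oo.
  apply: contra_neq rhsf => moo; rewrite /rhs; apply: eqy_poweR.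
    by rewrite invr_gt0.
  apply/eqP; rewrite -leye_eq -moo.
  exact: (@esum_ge_term _ _ (fun m => ((wt m)%:E * cov n m) `^ u)).
have covf m : cov n m \is a fin_num.
  rewrite ge0_fin_numE// ltey; apply: contra (wcovf m) => /eqP ->.
  by rewrite gt0_muley ?lte_fin// poweRyr// gt_eqF.
have key e : (0 < e)%R -> covering_mix mu u wt pic Pm n <= (1 + e)%:E * rhs.
  move=> e0; have e1 : (0 < 1 + e)%R by rewrite addr_gt0.
  have /choice[f hf] m : exists p : set nat * (nat -> T -> R),
      ball_cover mu (ball_radius u n) (Pm m) p.1 p.2 /\
      (\esum_(j in p.1) (pic m (L1ball mu (p.2 j) (ball_radius u n))) `^ u) `^ u^-1
        <= (1 + e)%:E * cov n m.
    (* Strict because [cov n m] is finite and at least 1; hence some cover has a value below the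
       right side. *)
    have : cov n m < (1 + e)%:E * cov n m.
      rewrite -(fineK (covf m)) -EFinM lte_fin ltr_pMl ?ltrDl//.
      by rewrite -lte_fin fineK// (lt_le_trans _ (cov1 n m)).
    by case/ereal_inf_lt => _ [J [c [hc ->]]] /ltW le; exists (J, c).
  apply: (@le_trans _ _ ((\esum_(m in [set: M]) \esum_(j in (f m).1)
      ((wt m)%:E * pic m (L1ball mu ((f m).2 j) (ball_radius u n))) `^ u) `^ u^-1)).
    apply: ereal_inf_lbound; exists (fun m => (f m).1), (fun m => (f m).2).
    by split => // m; case: (hf m).
  have -> : (1 + e)%:E * rhs = (((1 + e) `^ u)%:E *
      \esum_(m in [set: M]) ((wt m)%:E * cov n m) `^ u) `^ u^-1.
    rewrite poweRM ?lee_fin ?powR_ge0 ?esum_ge0//; congr (_ * _).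
    by rewrite -poweR_EFin poweRKV// lee_fin ltW.
  apply: le_poweR => //.
    by apply: esum_ge0 => m _; apply: esum_ge0 => j _; exact: poweR_ge0.
  rewrite -esumZl ?powR_gt0//; apply: le_esum => m _.
  have w0 : 0 <= (wt m)%:E by rewrite lee_fin ltW.
  rewrite esum_weighted// -poweR_EFin -poweRM ?lee_fin ?(ltW e1) ?mule_ge0//.
  apply: le_poweR; [exact: ltW|by rewrite mule_ge0// poweR_ge0|].
  rewrite muleCA lee_wpmul2l//.
  by case: (hf m).
apply/lee_addgt0Pr => e e0.
have rf : rhs \is a fin_num by rewrite ge0_fin_numE// ltey.
have r0 : (0 <= fine rhs)%R by rewrite fine_ge0.
have r1 : (0 < fine rhs + 1)%R by rewrite ltr_wpDl.
apply: le_trans (key (e / (fine rhs + 1))%R _) _; first by rewrite divr_gt0.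
rewrite -(fineK rf) -EFinM -EFinD lee_fin mulrDl mul1r lerD2l mulrAC.
by rewrite ler_pdivrMr// ler_wpM2l ?(ltW e0)// lerDl.
Qed.

Hypothesis hwt1 : \esum_(m in [set: M]) (wt m)%:E = 1.

(** Every weight is at most its power [u], the covering numbers are at least 1 and the weights sum
    to 1. This keeps the logarithm in the bound away from [-oo]. *)
Lemma covering_mix_ge1 n : 1 <= covering_mix mu u wt pic Pm n.
Proof.
rewrite covering_mixE; apply: le1_poweR; first by rewrite invr_gt0.
rewrite -hwt1; apply: le_esum => m _.
have w1 : (wt m <= 1)%R.
  rewrite -lee_fin -hwt1; apply: (@esum_ge_term _ _ (fun m => (wt m)%:E)) => //.
  by move=> j; rewrite lee_fin ltW.
apply: (@le_trans _ _ ((wt m)%:E `^ u)).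
  by rewrite poweR_EFin lee_fin ger1_powR// hwt.
apply: le_poweR; [exact: ltW|by rewrite lee_fin ltW|].
by rewrite -[leLHS]mule1 lee_wpmul2l ?lee_fin ?(ltW (hwt m)).
Qed.

End covering.

(** Pieces indexed by a countable type are listed by their codes. Codes are injective, and a number
    that is no code contributes 0. *)
Lemma nneseries_pickle_inv (R : realType) (I : countType) (a : I -> \bar R) :
  (forall i, 0 <= a i) ->
  \sum_(n <oo) (if pickle_inv n is Some i then a i else 0) <= \esum_(i in [set: I]) a i.
Proof.
move=> a0; rewrite nneseries_esumT; last by move=> n; case: pickle_inv.
pose b n := if pickle_inv n is Some i then a i else 0.
have -> : \esum_(i in [set: I]) a i = \esum_(i in [set: I]) b (pickle i).
  by apply: eq_esum => i _; rewrite /b pickleK_inv.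
rewrite -(esum_image [set: I] (@pickle I) b); last first.
  by move=> i j _ _; exact: (pcan_inj pickleK).
rewrite [leRHS]esum_mkcond; apply: le_esum => n _.
case: ifPn => // nim; case E : (pickle_inv n) => [i|//].
exfalso; move/negP: nim; apply; rewrite inE; exists i => //.
by have := @pickle_invK I n; rewrite E.
Qed.

(** * Concentration of the posterior *)

Section rate.
Context {R : realType}.

(* The exponents [s1] and [s2] turn [u], [t] into the common power
   [al = u * t / (u + t)], and [al * (2 * (u^-1 + t^-1)) = 2] makes the factor
   [n `^ (2 * (u^-1 + t^-1))] of the bound produce the summable rate [n ^- 2]. *)
Lemma posterior_rate (u t Dr N k delta eps : R) (n : nat) :
  (0 < u)%R -> (u < 1)%R -> (0 < t)%R -> (1 <= N)%R -> (0 < k)%R -> (0 < n)%N ->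
  (delta - n%:R^-1 * ln k < Dr + n%:R^-1)%R ->
  eps = (Dr + n%:R^-1 * ln (N * n%:R `^ (2 * (u^-1 + t^-1))))%R ->
  ((expR (- u * eps + 2 / n%:R) ^+ n * (2 * N) `^ u) `^ (t / (u + t)) *
   (expR (t * delta) ^+ n * k `^ (- t)) `^ (u / (u + t)) <= expR 5 / n%:R ^+ 2)%R.
Proof.
move=> u0 u1 t0 N1 k0 n0 hd epsE.
have nr0 : (0 < n%:R :> R)%R by rewrite ltr0n.
have N0 : (0 < N)%R by exact: lt_le_trans N1.
have ut0 : (0 < u + t)%R by rewrite addr_gt0.
set a := (2 * (u^-1 + t^-1))%R in epsE *.
have lneps : (n%:R * eps = n%:R * Dr + (ln N + a * ln n%:R))%R.
  rewrite epsE lnM ?posrE ?powR_gt0// ln_powR mulrDr mulrA mulfV ?mul1r//.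
  by rewrite gt_eqF.
have hd' : (n%:R * delta - ln k < n%:R * Dr + 1)%R.
  move: hd; rewrite -(ltr_pM2l nr0) mulrBr mulrDr mulrA mulfV ?mul1r ?gt_eqF//.
have powE x y : (0 < x -> x `^ y = expR (y * ln x) :> R)%R.
  by move=> x0; rewrite /powR gt_eqF.
rewrite (powE (2 * N)%R) ?mulr_gt0// (powE k)// -!expRM_natl -!expRD -!expRM -expRD.
have -> : (n%:R ^+ 2 = expR (2 * ln n%:R) :> R)%R.
  by rewrite mulr_natl mulr2n expRD lnK ?posrE// expr2.
rewrite -expRN -expRD ler_expR lnM ?posrE//.
(* The constant 5 is 1 + 2 + 2: at most 1 from the slack [n%:R^-1] in the choice of [K], at most 2
   from [al * ln 2], and at most 2 from the diameter error [2 / n%:R] over [n] observations. *)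
have ln2 : (ln 2 < 2 :> R)%R by apply: ln_sublinear.
set al := (u * t / (u + t))%R.
have al0 : (0 < al)%R by rewrite !divr_gt0// mulr_gt0.
have ala : (al * a = 2)%R by rewrite /al /a; field; rewrite !gt_eqF.
have c1 : (t / (u + t) <= 1)%R by rewrite ler_pdivrMr// mul1r lerDr ltW.
have al1 : (al <= 1)%R.
  rewrite /al -mulrA; apply: mulr_ile1 => //; rewrite ?ltW//.
  by rewrite divr_gt0.
have -> : ((n%:R * (- u * eps + 2 / n%:R) + u * (ln 2 + ln N)) * (t / (u + t)) +
    (n%:R * (t * delta) + - t * ln k) * (u / (u + t)) =
    al * (- (n%:R * eps) + ln 2 + ln N + (n%:R * delta - ln k)) + 2 * (t / (u + t)))%R.
  by rewrite /al; field; rewrite !gt_eqF.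
rewrite lneps.
have h1 : (al * (n%:R * delta - ln k) <= al * (n%:R * Dr + 1))%R.
  by rewrite ler_pM2l// ltW.
have -> : (al * (- (n%:R * Dr + (ln N + a * ln n%:R)) + ln 2 + ln N +
    (n%:R * delta - ln k)) = - (al * a) * ln n%:R - al * (n%:R * Dr) +
    al * (n%:R * delta - ln k) + al * ln 2)%R by ring.
rewrite ala.
have h2 : (al * ln 2 <= 1 * 2)%R.
  apply: ler_pM => //; first exact: ltW; last exact: ltW.
  by apply/ltW/ln_gt0; rewrite ltr1n.
have h3 : (al * (n%:R * Dr + 1) = al * (n%:R * Dr) + al)%R by rewrite mulrDr mulr1.
move: h1 c1; rewrite h3; move: (al * (n%:R * Dr))%R (al * ln 2)%R h2.
move: (al * (n%:R * delta - ln k))%R (t / (u + t))%R (ln n%:R) => *; lra.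
Qed.

(** Telescoping: with [x = m.+1], the next term [1/(x+1)^2] is at most [1/x - 1/(x+1)]. *)
Lemma inv_sqr_partial_sum (C : R) m : (0 <= C)%R ->
  (\sum_(0 <= i < m.+1) C / i.+1%:R ^+ 2 <= C * (2 - m.+1%:R^-1))%R.
Proof.
move=> C0; elim: m => [|m IH].
  by rewrite big_nat1 expr1n invr1; lra.
rewrite big_nat_recr//=; apply: le_trans (lerD IH (lexx _)) _.
rewrite -mulrDr ler_wpM2l// -addrA lerD2l -(natr1 m.+1).
set x := m.+1%:R; have x0 : (0 < x :> R)%R by rewrite ltr0n.
have x1 : (0 < x + 1 :> R)%R by rewrite addr_gt0.
rewrite -subr_ge0.
have -> : (- (x + 1)^-1 - (- x^-1 + ((x + 1) ^+ 2)^-1) = (x * (x + 1) ^+ 2)^-1)%R.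
  by field; rewrite !gt_eqF.
by rewrite invr_ge0 mulr_ge0 ?exprn_ge0 ?ltW.
Qed.

Lemma inv_sqr_series_lty (C : R) : (0 <= C)%R ->
  \sum_(i <oo) (C / i.+1%:R ^+ 2)%:E < +oo.
Proof.
move=> C0; apply: (@le_lt_trans _ _ (C * 2)%:E); last exact: ltry.
have t0 i : (0 <= C / i.+1%:R ^+ 2)%R by rewrite divr_ge0// exprn_ge0.
apply: lime_le; first by apply: is_cvg_nneseries => i _ _; rewrite lee_fin.
apply: nearW => m; rewrite sumEFin lee_fin.
have h : (\sum_(0 <= i < m.+1) C / i.+1%:R ^+ 2 <= C * 2)%R.
  by apply: le_trans (inv_sqr_partial_sum m C0) _; rewrite ler_wpM2l// gerBl.
by apply: le_trans h; rewrite big_nat_recr//= lerDl.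
Qed.

End rate.

(** * Exceptional sets, their posterior mass and Borel-Cantelli *)

Section deviation.
Context {d : measure_display} {T : measurableType d} {R : realType}.
Variable mu : {sigma_finite_measure set T -> \bar R}.
Variable G : set (set (T -> R)).
Local Notation D := (g_sigma_algebraType G).
Hypothesis hball : forall (c : T -> R) (r : R), is_density mu c ->
  measurable (L1ball mu c r : set D).
Variable p0 : T -> R.
Hypothesis hp0 : is_density mu p0.
Variables (M : countType) (wt : M -> R) (pic : M -> probability D R)
  (Pm : M -> set D).
Hypotheses (hwt : forall m, (0 < wt m)%R)
  (hwt1 : \esum_(m in [set: M]) (wt m)%:E = 1)
  (hPm : forall m, measurable (Pm m))
  (hPmdens : forall m, Pm m `<=` [set f | is_density mu f])
  (hPm1 : forall m, pic m (Pm m) = 1)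
  (hPmdisj : forall m m', m <> m' -> Pm m `&` Pm m' = set0).
Variable P : set D.
Hypothesis hP : P = \bigcup_m Pm m.
Hypothesis heval : measurable_fun (P `*` [set: T])
     (fun z : D * T => (z.1 : T -> R) z.2).
Variable pi : probability D R.
Hypothesis hpi : forall A : set D, measurable A ->
     pi A = \esum_(m in [set: M]) ((wt m)%:E * pic m A).
Variables (u t : R).
Hypotheses (u0 : (0 < u)%R) (u1 : (u < 1)%R) (t0 : (0 < t)%R).

Let Pdens f : P f -> is_density mu f.
Proof. by rewrite hP => -[m _ /hPmdens]. Qed.

Let mP : measurable P.
Proof.
have -> : P = \bigcup_n (if @pickle_inv M n is Some m then Pm m else set0).
  rewrite hP; apply/seteqP; split => [f [m _ fm]|f [n _]].
    by exists (pickle m) => //; rewrite pickleK_inv.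
  by case: pickle_inv => // m fm; exists m.
apply: bigcupT_measurable => n; case: pickle_inv => [m|]; first exact: hPm.
exact: measurable0.
Qed.

(** Evaluation extended by 0 outside [P], so that it is nonnegative and jointly measurable on the
    whole product space. *)
Let F (f : D) (y : T) : R := ((fun z : D * T => (z.1 : T -> R) z.2) \_ (P `*` setT)) (f, y).

Let FE f : P f -> F f = f.
Proof. by move=> Pf; apply/funext => y; rewrite /F patchE mem_set. Qed.

Let F0 f y : (0 <= F f y)%R.
Proof.
rewrite /F patchE; case: ifPn => // /set_mem[/= Pf _].
by case: (Pdens Pf).
Qed.

Let mF : measurable_fun [set: D * T] (fun z => F z.1 z.2).
Proof.
have := heval; rewrite measurable_restrictT; last exact: measurableX.
by rewrite /F; under [X in _ -> measurable_fun _ X]eq_fun do rewrite -surjective_pairing.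
Qed.

(** Disjointness of the models: [pic m'] is concentrated on [Pm m'], which misses [A] for every
    other [m'], so only the term of [m] survives. *)
Let pi_Pm_le m (A : set D) : measurable A -> A `<=` Pm m ->
  pi A <= (wt m)%:E * pic m A.
Proof.
move=> mA Am; rewrite hpi//.
rewrite (_ : \esum_(m' in _) _ =
    \esum_(m' in [set m]) ((wt m')%:E * pic m' A)).
  by rewrite esum_set1// mule_ge0// lee_fin ltW.
rewrite [RHS]esum_mkcond; apply: eq_esum => m' _.
case: ifPn => //; rewrite notin_setE => /= mm'.
suff -> : pic m' A = 0 by rewrite mule0.
apply/eqP; rewrite -measure_le0.
have sub : A `<=` ~` Pm m'.
  move=> f /Am fm fm'; have := hPmdisj mm'; rewrite -subset0 => /(_ f).
  by apply; split.
apply: (@le_trans _ _ (pic m' (~` Pm m'))).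
  by apply: le_measure => //; rewrite inE//; exact: measurableC.
by rewrite probability_setC// hPm1 subee.
Qed.

Let L1ball_diam c r f g : is_density mu c -> L1ball mu c r f -> L1ball mu c r g ->
  \int[mu]_y `|f y - g y|%:E <= (2 * r)%:E.
Proof.
move=> [mc _ _] [[mf _ _] fr] [[mg _ _] gr].
have mabs (h h' : T -> R) : measurable_fun setT h -> measurable_fun setT h' ->
    measurable_fun setT (fun y => `|h y - h' y|%:E).
  move=> mh mh'; apply/measurable_EFinP; apply: measurableT_comp => //.
  exact: measurable_funB.
apply: (@le_trans _ _ (\int[mu]_y (`|f y - c y|%:E + `|g y - c y|%:E))).
  apply: ge0_le_integralT => y; first by rewrite lee_fin.
  by rewrite -EFinD lee_fin (distrC (g y)) ler_distD.
rewrite ge0_integralD//; [|exact: mabs..].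
by rewrite mulr2n mulrDl !mul1r EFinD; apply: leeD; exact: ltW.
Qed.

Let Pmle m f : Pm m f -> P f.
Proof. by move=> fm; rewrite hP; exists m. Qed.

Definition far (e : R) : set D := [set f | P f /\ e%:E < dsq mu (- u) p0 f].

Lemma far_affinity e f : far e f ->
  \int[mu]_y (p0 y `^ (1 - u) * F f y `^ u)%:E <= (1 - u * e)%:E.
Proof.
move=> [Pf]; have [r rE ->] := affinity_dsq u0 u1 hp0 (Pdens Pf).
rewrite FE// rE !lte_fin lee_fin => h.
have : (u * e < u * (u^-1 * (1 - r)))%R by rewrite ltr_pM2l.
by rewrite mulrA mulfV ?gt_eqF// mul1r; lra.
Qed.

(** Within [P] this is a strict sublevel set of the affinity, a measurable function of the density
    by Tonelli. *)
Lemma measurable_far e : measurable (far e).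
Proof.
have mp0 : measurable_fun setT p0 by case: hp0.
pose h (f : D) := \int[mu]_y (p0 y `^ (1 - u) * F f y `^ u)%:E.
have mh : measurable_fun setT h.
  apply: (measurable_fun_fubini_tonelli_F (fun z : D * T =>
    (p0 z.2 `^ (1 - u) * F z.1 z.2 `^ u)%:E)).
    apply/measurable_EFinP; apply: measurable_funM.
      apply: (measurableT_comp (measurable_powR _)).
      exact: (measurableT_comp mp0 measurable_snd).
    exact: (measurableT_comp (measurable_powR _) mF).
  by move=> z; rewrite lee_fin mulr_ge0 ?powR_ge0.
have -> : far e = P `&` (setT `&` [set f | h f < (1 - u * e)%:E]).
  have equiv f : P f -> (e%:E < dsq mu (- u) p0 f) = (h f < (1 - u * e)%:E).
    move=> Pf; have [r rE dE] := affinity_dsq u0 u1 hp0 (Pdens Pf).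
    rewrite /h FE// rE dE !lte_fin -(ltr_pM2l u0) mulrA mulfV ?gt_eqF// mul1r.
    by rewrite !ltrBrDl addrC.
  rewrite setTI; apply/seteqP; split => f [Pf] /= hf; split => //=.
    by rewrite -equiv.
  by rewrite equiv.
by apply: measurableI => //; exact: emeasurable_fun_infty_o.
Qed.

Local Notation rhs := (fun n => dsq_prior mu t p0 P pi n
       + (n%:R^-1)%:E * lne (covering_mix mu u wt pic Pm n
                             * (n%:R `^ (2 * (u^-1 + t^-1)))%:E)).

Let dsq_prior_gtNy n : -oo < dsq_prior mu t p0 P pi n.
Proof.
apply: (@lt_le_trans _ _ (- t^-1)%:E); first by rewrite ltNyr.
apply: le_ereal_inf_tmp => _ [K [mK KP [q Kq] ->]].
rewrite -[leLHS]adde0; apply: leeD.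
  apply: le_trans (dsq_ge t0 hp0 (Pdens (KP _ Kq))) _.
  by apply: ereal_sup_ubound; exists q.
rewrite oppe_ge0 mule_ge0_le0 ?lee_fin ?invr_ge0//.
by rewrite lne_le0 probability_le1.
Qed.

(** Neither term can be [-oo], so a sum different from [+oo] forces both to be finite. *)
Let rhs_fin n : (0 < n)%N -> rhs n != +oo ->
  exists Dr N : R, [/\ dsq_prior mu t p0 P pi n = Dr%:E,
    covering_mix mu u wt pic Pm n = N%:E & (1 <= N)%R].
Proof.
move=> n0; have n0r : (0 < n%:R :> R)%R by rewrite ltr0n.
have nV0 : (0 < n%:R^-1 :> R)%R by rewrite invr_gt0.
have npow : (0 < n%:R `^ (2 * (u^-1 + t^-1)) :> R)%R by rewrite powR_gt0.
have := covering_mix_ge1 hball u0 (ltW u1) hwt hPm hPm1 hwt1 n.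
have := dsq_prior_gtNy n.
case: (dsq_prior mu t p0 P pi n) => [Dr| |]//;
  case: (covering_mix mu u wt pic Pm n) => [N| |]// _.
- by rewrite lee_fin => N1 _; exists Dr, N.
- by rewrite gt0_mulye ?lte_fin//= gt0_muley ?lte_fin// addey.
- rewrite lee_fin => N1.
  rewrite -EFinM lne_EFin ?mulr_gt0 ?(lt_le_trans _ N1)// -EFinM addye//.
- by rewrite gt0_mulye ?lte_fin//= gt0_muley ?lte_fin// addey.
Qed.

(** [K] attains the infimum in [dsq_prior] up to [n%:R^-1]. Its value is finite, which rules out an
    infinite supremum and a null set. *)
Lemma prior_concentration n Dr : (0 < n)%N -> dsq_prior mu t p0 P pi n = Dr%:E ->
  exists (K : set D) (k delta : R), [/\ measurable K, K `<=` P, pi K = k%:E,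
    (0 < k)%R & (delta - n%:R^-1 * ln k < Dr + n%:R^-1)%R] /\
    (forall q, K q -> dsq mu t p0 q <= delta%:E).
Proof.
move=> n0 DE; have nV0 : (0 < n%:R^-1 :> R)%R by rewrite invr_gt0 ltr0n.
have : dsq_prior mu t p0 P pi n < (Dr + n%:R^-1)%:E.
  by rewrite DE lte_fin ltrDl.
case/ereal_inf_lt => _ [K [mK KP [q Kq] ->]].
have sge : (- t^-1)%:E <= ereal_sup [set dsq mu t p0 q | q in K].
  apply: le_trans (dsq_ge t0 hp0 (Pdens (KP _ Kq))) _.
  by apply: ereal_sup_ubound; exists q.
have pK1 : pi K <= 1 by exact: probability_le1.
have pK0 : 0 <= pi K by exact: measure_ge0.
case Es : (ereal_sup [set dsq mu t p0 q | q in K]) sge => [s| |] // _;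
case Ek : (pi K) pK0 pK1 => [k| |] // k0 k1 lt.
- exists K, k, s; move: k0; rewrite lee_fin le_eqVlt => /predU1P[k0|k0].
    by move: lt; rewrite -k0 /= lexx gt0_muleNy ?lte_fin.
  split; last first.
    by move=> q' Kq'; rewrite -Es; apply: ereal_sup_ubound; exists q'.
  by split => //; move: lt; rewrite lne_EFin.
- move: lt; have : n%:R^-1%:E * lne k%:E != +oo.
    rewrite /=; case: ifPn => _ //.
    by rewrite gt0_muleNy ?lte_fin.
  by case: (n%:R^-1%:E * lne k%:E).
Qed.

Let r n : R := ball_radius u n.

(** The pieces are the balls of a nearly optimal cover, each cut down to its model and listed by the
    code of [(m, j)]. The cut lets only the weight of that model enter the prior mass of a piece. *)
Lemma cover_pieces n (N : R) : (0 < n)%N -> (1 <= N)%R ->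
  covering_mix mu u wt pic Pm n = N%:E ->
  exists S : (set D)^nat, [/\ forall i, measurable (S i),
    P `<=` \bigcup_i S i, forall i, S i `<=` P,
    forall i f g, S i f -> S i g -> \int[mu]_y `|f y - g y|%:E <= (2 * r n)%:E
    & forall A, measurable A ->
      \sum_(i <oo) (pi (A `&` S i)) `^ u <= ((2 * N) `^ u)%:E].
Proof.
move=> n0 N1 NE; have N0 : (0 < N)%R by exact: lt_le_trans N1.
(* The factor 2 leaves room above the infimum; it costs only a constant in the final rate. *)
have : covering_mix mu u wt pic Pm n < (2 * N)%:E.
  by rewrite NE lte_fin ltr_pMl// ltr1n.
case/ereal_inf_lt => _ [J [c [cov ->]]] lt.
have dens m j : J m j -> is_density mu (c m j) by case: (cov m) => + _; apply.
pose B m j := L1ball mu (c m j) (r n) : set D.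
pose S i : set D := if pickle_inv i is Some (m, j) then
  (if j \in J m then Pm m `&` B m j else set0) else set0.
have mS i : measurable (S i).
  rewrite /S; case: pickle_inv => [[m j]|]; last exact: measurable0.
  case: ifPn => [/set_mem Jmj|_]; last exact: measurable0.
  by apply: measurableI => //; apply: hball; exact: dens.
exists S; split => //.
- move=> f; rewrite hP => -[m _ fm]; have [_ /(_ f fm)[j Jmj fj]] := cov m.
  by exists (pickle (m, j)) => //; rewrite /S pickleK_inv mem_set.
- move=> i f; rewrite /S; case: pickle_inv => [[m j]|]//.
  by case: ifPn => // _ [/Pmle].
- move=> i f g; rewrite /S; case: pickle_inv => [[m j]|]//.
  case: ifPn => // /set_mem Jmj [_ fB] [_ gB].
  exact: (L1ball_diam (dens _ _ Jmj)).
move=> A mA.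
pose b (k : M * nat) : \bar R := if k.2 \in J k.1 then
  ((wt k.1)%:E * pic k.1 (B k.1 k.2)) `^ u else 0.
have b0 k : 0 <= b k by rewrite /b; case: ifP => // _; exact: poweR_ge0.
apply: (@le_trans _ _ (\sum_(i <oo)
    (if @pickle_inv (M * nat)%type i is Some k then b k else 0))).
  apply: lee_nneseries => i _; first by move=> _; exact: poweR_ge0.
  rewrite /S; case: pickle_inv => [[m j]|]; last first.
    by rewrite setI0 measure0 poweR0r// gt_eqF.
  rewrite /b /=; case: ifPn => [/set_mem Jmj|_]; last first.
    by rewrite setI0 measure0 poweR0r// gt_eqF.
  have mB : measurable (B m j) by apply: hball; exact: dens.
  have mAB : measurable (A `&` (Pm m `&` B m j)).
    by apply: measurableI => //; exact: measurableI.
  apply: le_poweR; [exact: ltW|exact: measure_ge0|].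
  apply: le_trans (@pi_Pm_le m _ mAB _) _; first by move=> f [_ []].
  rewrite lee_wpmul2l ?lee_fin ?(ltW (hwt m))//.
  by apply: le_measure; rewrite ?inE// => f [_ []].
apply: le_trans (nneseries_pickle_inv b0) _.
have -> : \esum_(k in [set: M * nat]) b k = \esum_(m in [set: M]) \esum_(j in J m)
    ((wt m)%:E * pic m (B m j)) `^ u.
  rewrite (_ : [set: M * nat] = [set: M] `*`` (fun=> [set: nat])); last first.
    by apply/seteqP; split.
  rewrite -(esum_esum (a := fun m j => b (m, j)))//.
  by apply: eq_esum => m _; rewrite [RHS]esum_mkcond.
rewrite -poweR_EFin -[leLHS](poweRVK u0); last first.
  by apply: esum_ge0 => m _; apply: esum_ge0 => j _; exact: poweR_ge0.
by apply: le_poweR; [exact: ltW|exact: poweR_ge0|exact: ltW].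
Qed.

Let r_gt0 n : (0 < n)%N -> (0 < r n)%R.
Proof. by move=> n0; rewrite powR_gt0// ltr0n. Qed.

(** The radius is chosen for this: its power [u] is [n%:R^-1], and 2 to the power [u] is at most
    2. *)
Let diam_pow n : (0 < n)%N -> ((2 * r n) `^ u <= 2 / n%:R)%R.
Proof.
move=> n0; have n0r : (0 < n%:R :> R)%R by rewrite ltr0n.
rewrite powRM ?(ltW (r_gt0 n0))// /r /ball_radius -powRrM mulNr mulVf ?gt_eqF//.
rewrite (powR_inv1 (ltW n0r)) ler_wpM2r ?invr_ge0 ?(ltW n0r)//.
by apply: ler1_powR; rewrite ?ler1n// ltW.
Qed.

Variables (dO : measure_display) (O : measurableType dO) (Pr : probability O R).
Variable p : nat -> {RV Pr >-> D}.
Hypothesis hp : posterior_sequence mu pi P p0 p.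

(** If the bound is finite, [A] is the set of densities violating it; [posterior_mass_le] and
    [posterior_rate] give its mass. If the bound is infinite, the empty set will do. *)
Lemma posterior_deviation n : (0 < n)%N -> exists A : set D,
  [/\ measurable A, forall f, P f -> ~ A f -> dsq mu (- u) p0 f <= rhs n
    & Pr (p n @^-1` A) <= (expR 5 / n%:R ^+ 2)%:E].
Proof.
move=> n0; have n0r : (0 < n%:R :> R)%R by rewrite ltr0n.
have [rhsy|rhsf] := eqVneq (rhs n) +oo.
  exists set0; split => [|f _ _|]; first exact: measurable0.
    by rewrite rhsy leey.
  by rewrite preimage_set0 measure0 lee_fin divr_ge0 ?expR_ge0// exprn_ge0.
have [Dr [N [DE NE N1]]] := rhs_fin n0 rhsf.
have N0 : (0 < N)%R by exact: lt_le_trans N1.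
have [K [k [delta [[mK KP piK k0 lt] Kdsq]]]] := prior_concentration n0 DE.
have [S [mS PS SP diam Ssum]] := cover_pieces n0 N1 NE.
pose eps := (Dr + n%:R^-1 * ln (N * n%:R `^ (2 * (u^-1 + t^-1))))%R.
have rhsE : rhs n = eps%:E.
  by rewrite DE NE -EFinM lne_EFin ?mulr_gt0 ?powR_gt0.
have farP : far eps `<=` P by move=> f [].
exists (far eps); split; first exact: measurable_far.
  move=> f Pf nA; rewrite rhsE leNgt; apply/negP => h.
  by apply: nA; split.
have [_ _ /(_ (far eps) (measurable_far eps) farP) ->] := hp n0.
have wE (Y : n.-tuple T) (A : set D) : A `<=` P ->
    weighted_likelihood pi Y A = \int[pi]_(x in A) (likelihood Y (F x))%:E.
  by move=> AP; apply: eq_integral => f /set_mem /AP Pf; rewrite FE.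
under eq_iter_integral do rewrite !wE//.
have [mp0 p00 p01] := hp0.
(* Intersecting with the far set gives every density in a piece the small affinity that the
   numerator bound requires. *)
pose Sb i := far eps `&` S i.
have mSb i : measurable (Sb i) by apply: measurableI => //; exact: measurable_far.
have bSb : far eps `<=` \bigcup_i Sb i.
  by move=> f bf; have [i _ Sif] := PS f (farP f bf); exists i.
have dSb i f g : Sb i f -> Sb i g -> \int[mu]_y `|F f y - F g y|%:E <= (2 * r n)%:E.
  by move=> [bf Sf] [bg Sg]; rewrite !FE; [exact: (diam i)|exact: SP Sg|exact: SP Sf].
have aSb i f : Sb i f ->
    \int[mu]_y (p0 y `^ (1 - u) * F f y `^ u)%:E <= (1 - u * eps)%:E.
  by move=> [bf _]; exact: far_affinity.
have E0 : (0 < 2 * r n)%R by rewrite mulr_gt0// r_gt0.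
have th0 x : (0 < expR x :> R)%R by exact: expR_gt0.
(* The exponential form of [theta] comes from [1 + x <= expR x], so that its [n]-th power is
   explicit. *)
have thE : (1 - u * eps + (2 * r n) `^ u <= expR (- u * eps + 2 / n%:R))%R.
  apply: le_trans (expR_ge1Dx _); rewrite mulNr addrA lerD2l.
  exact: diam_pow.
have mom f : K f -> \int[mu]_y invmom t (p0 y) (F f y) <= (expR (t * delta))%:E.
  move=> Kf; have Pf := KP _ Kf; rewrite FE//.
  by apply: (@invmom_le_expR _ _ _ mu) => //; [exact: Pdens|exact: Kdsq].
have B0 : (0 < (2 * N) `^ u)%R by rewrite powR_gt0// mulr_gt0.
apply: le_trans (posterior_mass_le (nu := pi) F0 mF mp0 p00 p01 u0 u1 t0 E0
  mK mP (measurable_far eps) mSb farP KP bSb dSb aSb (th0 _) thE (th0 _) mom k0 piK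
  B0 (Ssum _ (measurable_far eps)) n) _.
rewrite lee_fin; exact: (posterior_rate u0 u1 t0 N1 k0 n0 lt).
Qed.

(** The exceptional probabilities are summable, so the Borel-Cantelli lemma applies; this direction
    uses only the marginal laws of the [p n]. *)
Lemma posterior_eventually :
  \forall w \ae Pr, \forall n \near \oo, dsq mu (- u) p0 (p n w) <= rhs n.
Proof.
have /choice[A hA] (n : nat) : exists A : set D, (0 < n)%N ->
    [/\ measurable A, forall f, P f -> ~ A f -> dsq mu (- u) p0 f <= rhs n
      & Pr (p n @^-1` A) <= (expR 5 / n%:R ^+ 2)%:E].
  have [n0|n0] := ltnP 0 n; last by exists set0.
  by have [A hA] := posterior_deviation n0; exists A.
(* Shifted by one because the deviation bound starts at [n = 1]; the set chosen for [n = 0] is a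
   dummy. *)
pose E k : set O := p k.+1 @^-1` A k.+1.
have mE k : measurable (E k).
  have [mA _ _] := hA k.+1 isT.
  by rewrite -[E k]setTI; apply: (measurable_funPT (p k.+1)).
have lim0 : Pr (lim_sup_set E) = 0.
  apply: lim_sup_set_cvg0 => //.
  apply: le_lt_trans (inv_sqr_series_lty (expR_ge0 5)).
  apply: lee_nneseries => k _; first by move=> _; exact: measure_ge0.
  by have [_ _] := hA k.+1 isT.
exists (lim_sup_set E); split => //.
  apply: bigcap_measurable => // n _; apply: bigcup_measurable => k _; exact: mE.
move=> w /=; apply: contra_notP => nw.
(* Outside the limsup only finitely many exceptional events occur. *)
have [n0 hn0] : exists n0, forall k, (n0 <= k)%N -> ~ E k w.
  apply: contrapT => h; apply: nw => n _.
  apply: contrapT => h2; apply: h; exists n => k nk Ek; apply: h2.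
  by exists k.
exists n0.+1 => // -[//|n] /= nn.
have [Pp _ _] := hp (ltn0Sn n).
have [_ dn _] := hA n.+1 isT.
by apply: dn => //; exact: hn0.
Qed.

End deviation.

Theorem mainTheorem6
  (d : measure_display) (T : measurableType d) (R : realType)
  (mu : {sigma_finite_measure set T -> \bar R})
  (G : set (set (T -> R)))
  (hball : forall (c : T -> R) (r : R), is_density mu c ->
     measurable (L1ball mu c r : set (g_sigma_algebraType G)))
  (p0 : T -> R) (hp0 : is_density mu p0)
  (M : countType) (wt : M -> R)
  (hwt : forall m, (0 < wt m)%R)
  (hwt1 : \esum_(m in [set: M]) (wt m)%:E = 1)
  (pic : M -> probability (g_sigma_algebraType G) R)
  (Pm : M -> set (g_sigma_algebraType G))
  (hPm : forall m, measurable (Pm m))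
  (hPmdens : forall m, Pm m `<=` [set f | is_density mu f])
  (hPm1 : forall m, pic m (Pm m) = 1)
  (hPmdisj : forall m m', m <> m' -> Pm m `&` Pm m' = set0)
  (P : set (g_sigma_algebraType G)) (hP : P = \bigcup_m Pm m)
  (heval : measurable_fun (P `*` [set: T])
     (fun z : g_sigma_algebraType G * T => (z.1 : T -> R) z.2))
  (pi : probability (g_sigma_algebraType G) R)
  (hpi : forall A : set (g_sigma_algebraType G), measurable A ->
     pi A = \esum_(m in [set: M]) ((wt m)%:E * pic m A))
  (dO : measure_display) (O : measurableType dO) (Pr : probability O R)
  (p : nat -> {RV Pr >-> g_sigma_algebraType G})
  (hp : posterior_sequence mu pi P p0 p)
  (u t : R)
  (hu : exists k : nat, (2 <= k)%N /\ u = (k%:R^-1)%R)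
  (ht : (0 < t)%R) :
  (\forall w \ae Pr, \forall n \near \oo,
     dsq mu (- u) p0 (p n w) <=
       dsq_prior mu t p0 P pi n
       + (n%:R^-1)%:E * lne (covering_mix mu u wt pic Pm n
                             * (n%:R `^ (2 * (u^-1 + t^-1)))%:E))
  /\
  (forall n, (0 < n)%N ->
     covering_mix mu u wt pic Pm n =
     (\esum_(m in [set: M])
        ((wt m)%:E * covering_cond mu u (pic m) (Pm m) n) `^ u) `^ u^-1).
Proof.
have [k [k2 uE]] := hu.
have k0 : (0 < k%:R :> R)%R by rewrite ltr0n (ltn_trans _ k2).
have u0 : (0 < u)%R by rewrite uE invr_gt0.
have u1 : (u < 1)%R by rewrite uE invf_lt1// ltr1n.
split.
  exact: (posterior_eventually hball hp0 hwt hwt1 hPm hPmdens hPm1 hPmdisj hP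
    heval hpi u0 u1 ht hp).
by move=> n _; exact: (covering_mixE hball u0 (ltW u1) hwt hPm hPm1).
Qed.
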